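(* Let $\mathbb{K}$ be a field of characteristic $0$, let $G$ be a finite abelian group acting linearly on a finite dimensional $\mathbb{K}$-vector space $V$, let $A$ be an abelian group and $\epsilon$ an antisymmetric bicharacter on $A$. Let $L=V\otimes\mathbb{K}G$ be a Yetter-Drinfeld $(A,\epsilon)$-color Lie ring over $\mathbb{K}G$ with purely positive part. Then the universal enveloping algebra $\mathcal{U}(L)$ has the PBW property: for an $A$-homogeneous basis $v_1,\dots,v_n$ of $V$, the images in $\mathcal{U}(L)$ of the elements $v_1^{m_1}v_2^{m_2}\cdots v_n^{m_n}g$ with $m_i\in\mathbb{N}$, $g\in G$ (where $v_i$ stands for $v_i\otimes 1_G\in L$ and $g\in\mathbb{K}G$) form a $\mathbb{K}$-basis of $\mathcal{U}(L)$.
   Context: Conventions: $\otimes=\otimes_{\mathbb{K}}$; $\mathbb{N}$ contains $0$; ${}^gv$ is the action of $g\in G$ on $v\in V$. Let $A$ be an abelian group (written multiplicatively). A bicharacter is a map $\epsilon:A\times A\to\mathbb{K}^*$ with $\epsilon(a,bc)=\epsilon(a,b)\epsilon(a,c)$, $\epsilon(ab,c)=\epsilon(a,c)\epsilon(b,c)$; it is antisymmetric if $\epsilon(b,a)=\epsilon(a,b)^{-1}$. Let $R=\bigoplus_{a\in A}R_a$ be an $A$-graded $\mathbb{K}$-algebra; an $A$-graded $R$-bimodule is an $R$-bimodule $L=\bigoplus_aL_a$ with $R_aL_bR_c\subset L_{abc}$. For $0\ne x$ in the degree-$a$ part write $|x|=a$ ($x$ is $A$-homogeneous); $|0|=1_A$.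 If $R=\mathbb{K}G$, each $g\in G$ is assumed $A$-homogeneous. An $(A,\epsilon)$-color Lie ring over $R$ is an $A$-graded $R$-bimodule $L$ with an $R$-bilinear, $R$-balanced operation $[\,,\,]:L\times L\to L$ (i.e. $\mathbb{K}$-bilinear with $[rx,ys]=r[x,y]s$ and $[xr,y]=[x,ry]$ for $r,s\in R$) such that for all $A$-homogeneous $x,y,z$: $[x,y]\in L_{|x||y|}$; $[x,y]=-\epsilon(|x|,|y|)[y,x]$; and $\epsilon(|z|,|x|)[x,[y,z]]+\epsilon(|x|,|y|)[y,[z,x]]+\epsilon(|y|,|z|)[z,[x,y]]=0$. Its universal enveloping algebra is $\mathcal{U}(L)=T_R(L)/J$, where $T_R(L)=\bigoplus_{m\ge0}L^{\otimes_Rm}$ and $J$ is the ideal generated by all $u\otimes_Rv-\epsilon(|u|,|v|)\,v\otimes_Ru-[u,v]$ with $u,v\in L$ $A$-homogeneous. The space $L=V\otimes\mathbb{K}G$ is a $\mathbb{K}G$-bimodule via $g(v\otimes h)g'={}^gv\otimes ghg'$. An $(A,\epsilon)$-color Lie ring structure on $L=V\otimes\mathbb{K}G$ over $\mathbb{K}G$ (with this bimodule structure) is Yetter-Drinfeld if (a) the $A$-grading on $L$ is induced from $A$-gradings on $V$ and $G$: $|v\otimes g|=|v||g|$ for $g\in G$ and $A$-homogeneous $v\in V$; and (b) ${}^gv=\epsilon(|g|,|v|)\,v$ for all $g\in G$ and $A$-homogeneous $v\in V$. It has purely positive part if $\epsilon(|v|,|v|)=1$ for every nonzero $A$-homogeneous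 $v\in V$.
   Formalization: The formal theorem adds the hypothesis that ε(|g|,|h|)=1 for all g,h in G whenever V≠0; without it the claim fails (if ε(|g|,|h|)≠1 for some g,h, then v²=0 in U(L) for homogeneous v in V), and the PBW property implies it. *)

(* Defs.v *)
(* MathComp, with finitely supported functions from multinomials; [boolp]
   provides the boolean form of the (undecidable) ideal membership used to form
   quotient types. *)
From HB Require Import structures.
From mathcomp Require Import all_boot all_order all_fingroup all_algebra.
From mathcomp Require Import generic_quotient ring_quotient.
From mathcomp Require Import boolp finmap.
From mathcomp Require Import monalg.

Set Implicit Arguments.
Unset Strict Implicit.
Unset Printing Implicit Defensive.

Import GRing.Theory.
Local Open Scope ring_scope.

Section LinearAlgebra.
Variable K : fieldType.

Inductive lspan (M : lmodType K) (S : M -> Prop) : M -> Prop :=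
| lspan0 : lspan S 0
| lspanZD (a : K) (x y : M) : S x -> lspan S y -> lspan S (a *: x + y).

Definition is_basis (I : eqType) (M : lmodType K) (b : I -> M) : Prop :=
  (forall x : M, exists (s : seq I) (c : I -> K),
      x = \sum_(i <- s) c i *: b i) /\
  (forall (s : seq I) (c : I -> K), uniq s ->
      \sum_(i <- s) c i *: b i = 0 -> forall i, i \in s -> c i = 0).

Section SpanTheory.
Variables (M : lmodType K) (S : M -> Prop).

Lemma lspan_in x : S x -> lspan S x.
Proof.
move=> Sx; rewrite -[x]addr0 -[x in x + _]scale1r.
by apply: lspanZD => //; apply: lspan0.
Qed.

Lemma lspanD x y : lspan S x -> lspan S y -> lspan S (x + y).
Proof.
elim=> [|a u v Su _ IH] Sy; first by rewrite add0r.
by rewrite -addrA; apply: lspanZD => //; apply: IH.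
Qed.

Lemma lspanZ a x : lspan S x -> lspan S (a *: x).
Proof.
elim=> [|b u v Su _ IH]; first by rewrite scaler0; apply: lspan0.
by rewrite scalerDr scalerA; apply: lspanZD.
Qed.

End SpanTheory.

End LinearAlgebra.

Section Ideals.
Variables (K : fieldType) (A : algType K).

(* Ideals are taken proper, so that every quotient is again an [algType]. *)
Record ideal := Ideal {
  ideal_mem :> A -> Prop;
  ideal0 : ideal_mem 0;
  ideal1 : ~ ideal_mem 1;
  idealD : forall x y, ideal_mem x -> ideal_mem y -> ideal_mem (x + y);
  idealMl : forall a x, ideal_mem x -> ideal_mem (a * x);
  idealMr : forall a x, ideal_mem x -> ideal_mem (x * a)
}.

Inductive ideal_gen (S : A -> Prop) : A -> Prop :=
| ideal_gen_in x : S x -> ideal_gen S x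
| ideal_gen0 : ideal_gen S 0
| ideal_genD x y : ideal_gen S x -> ideal_gen S y -> ideal_gen S (x + y)
| ideal_genMl a x : ideal_gen S x -> ideal_gen S (a * x)
| ideal_genMr a x : ideal_gen S x -> ideal_gen S (x * a).

Definition generated_ideal (S : A -> Prop) (S1 : ~ ideal_gen S 1) : ideal :=
  Ideal (@ideal_gen0 S) S1 (@ideal_genD S) (@ideal_genMl S) (@ideal_genMr S).

End Ideals.

Section QuotientAlgebra.
Local Open Scope quotient_scope.
Variables (K : fieldType) (A : algType K) (I : ideal A).

Definition idealb : {pred A} := fun x => `[< I x >].

Lemma idealbP x : reflect (I x) (x \in idealb).
Proof. exact: asboolP. Qed.

Lemma idealb_zmod_closed : zmod_closed idealb.
Proof.
split=> [|x y /idealbP Ix /idealbP Iy]; apply/idealbP; first exact: ideal0.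
by apply: idealD => //; rewrite -mulN1r; apply: idealMl.
Qed.

HB.instance Definition _ := GRing.isZmodClosed.Build A idealb idealb_zmod_closed.

Definition quotalg : Type := Quotient.quot (idealb : zmodClosed A).

HB.instance Definition _ := GRing.Zmodule.on quotalg.

Definition to_quot (x : A) : quotalg :=
  \pi_(Quotient.quot (idealb : zmodClosed A)) x.

Lemma to_quot_eq x y : to_quot x = to_quot y <-> I (x - y).
Proof.
rewrite /to_quot; split=> [/eqP|Ixy].
  by rewrite -Quotient.idealrBE => /idealbP.
by apply/eqP; rewrite -Quotient.idealrBE; apply/idealbP.
Qed.

Lemma to_quot_surj (q : quotalg) : exists x, q = to_quot x.
Proof.
by exists (repr (q : Quotient.quot (idealb : zmodClosed A))); rewrite /to_quot reprK.
Qed.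

Lemma to_quot_is_additive : zmod_morphism to_quot.
Proof. by move=> x y; rewrite /to_quot raddfB. Qed.

HB.instance Definition _ :=
  GRing.isZmodMorphism.Build A quotalg to_quot to_quot_is_additive.

Definition qrepr (q : quotalg) : A := repr (q : Quotient.quot (idealb : zmodClosed A)).

Lemma qreprK : cancel qrepr to_quot.
Proof. by move=> q; rewrite /to_quot /qrepr reprK. Qed.

Lemma qrepr_ideal x : I (qrepr (to_quot x) - x).
Proof. by apply/to_quot_eq; rewrite qreprK. Qed.

Definition quot_one : quotalg := to_quot 1.
Definition quot_mul (p q : quotalg) : quotalg := to_quot (qrepr p * qrepr q).
Definition quot_scale (k : K) (p : quotalg) : quotalg := to_quot (k *: qrepr p).

Lemma to_quotM x y : quot_mul (to_quot x) (to_quot y) = to_quot (x * y).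
Proof.
apply/to_quot_eq.
set x' := qrepr _; set y' := qrepr _.
have -> : x' * y' - x * y = (x' - x) * y' + x * (y' - y).
  by rewrite mulrBl mulrBr addrA subrK.
apply: idealD; first exact/idealMr/qrepr_ideal.
exact/idealMl/qrepr_ideal.
Qed.

Lemma to_quotZ k x : quot_scale k (to_quot x) = to_quot (k *: x).
Proof.
apply/to_quot_eq; rewrite -scalerBr -[_ - _]mul1r scalerAl.
exact/idealMl/qrepr_ideal.
Qed.

Lemma quot_mulA : associative quot_mul.
Proof.
move=> p q r.
have [[x ->] [y ->] [z ->]] :=
  And3 (to_quot_surj p) (to_quot_surj q) (to_quot_surj r).
by rewrite !to_quotM mulrA.
Qed.

Lemma quot_1mul : left_id quot_one quot_mul.
Proof.
by move=> p; have [x ->] := to_quot_surj p; rewrite to_quotM mul1r.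
Qed.

Lemma quot_mul1 : right_id quot_one quot_mul.
Proof.
by move=> p; have [x ->] := to_quot_surj p; rewrite to_quotM mulr1.
Qed.

Lemma quot_mulDl : left_distributive quot_mul +%R.
Proof.
move=> p q r.
have [[x ->] [y ->] [z ->]] :=
  And3 (to_quot_surj p) (to_quot_surj q) (to_quot_surj r).
by rewrite !to_quotM -!(raddfD to_quot) to_quotM mulrDl.
Qed.

Lemma quot_mulDr : right_distributive quot_mul +%R.
Proof.
move=> p q r.
have [[x ->] [y ->] [z ->]] :=
  And3 (to_quot_surj p) (to_quot_surj q) (to_quot_surj r).
by rewrite !to_quotM -!(raddfD to_quot) to_quotM mulrDr.
Qed.

Lemma quot_one_neq0 : quot_one != 0.
Proof.
apply/eqP; rewrite /quot_one -(raddf0 to_quot) => /to_quot_eq.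
by rewrite subr0; apply: ideal1.
Qed.

HB.instance Definition _ := GRing.Zmodule_isNzRing.Build quotalg
  quot_mulA quot_1mul quot_mul1 quot_mulDl quot_mulDr quot_one_neq0.

Lemma quot_scaleA a b p : quot_scale a (quot_scale b p) = quot_scale (a * b) p.
Proof. by have [x ->] := to_quot_surj p; rewrite !to_quotZ scalerA. Qed.

Lemma quot_scale1 : left_id 1 quot_scale.
Proof. by move=> p; have [x ->] := to_quot_surj p; rewrite to_quotZ scale1r. Qed.

Lemma quot_scaleDr : right_distributive quot_scale +%R.
Proof.
move=> a p q; have [x ->] := to_quot_surj p; have [y ->] := to_quot_surj q.
by rewrite !to_quotZ -!(raddfD to_quot) to_quotZ scalerDr.
Qed.

Lemma quot_scaleDl p : {morph quot_scale^~ p : a b / a + b}.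
Proof.
move=> a b; have [x ->] := to_quot_surj p.
by rewrite !to_quotZ -(raddfD to_quot) scalerDl.
Qed.

HB.instance Definition _ := GRing.Zmodule_isLmodule.Build K quotalg
  quot_scaleA quot_scale1 quot_scaleDr quot_scaleDl.

Let mulE x y : to_quot x * to_quot y = to_quot (x * y).
Proof. exact: to_quotM. Qed.

Let scaleE (k : K) x : k *: to_quot x = to_quot (k *: x).
Proof. exact: to_quotZ. Qed.

Lemma quot_scalerAl (k : K) (p q : quotalg) : k *: (p * q) = (k *: p) * q.
Proof.
have [x ->] := to_quot_surj p; have [y ->] := to_quot_surj q.
by rewrite mulE !scaleE mulE scalerAl.
Qed.

Lemma quot_scalerAr (k : K) (p q : quotalg) : k *: (p * q) = p * (k *: q).
Proof.
have [x ->] := to_quot_surj p; have [y ->] := to_quot_surj q.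
by rewrite mulE !scaleE mulE scalerAr.
Qed.

HB.instance Definition _ :=
  GRing.Lmodule_isLalgebra.Build K quotalg quot_scalerAl.
HB.instance Definition _ :=
  GRing.Lalgebra_isAlgebra.Build K quotalg quot_scalerAr.

Lemma to_quot_is_monoid_morphism : monoid_morphism to_quot.
Proof. by split=> // x y; rewrite -to_quotM. Qed.

HB.instance Definition _ := GRing.isMonoidMorphism.Build A quotalg to_quot
  to_quot_is_monoid_morphism.

Lemma to_quot_is_scalable : scalable to_quot.
Proof. by move=> k x; rewrite -to_quotZ. Qed.

HB.instance Definition _ := GRing.isScalable.Build K A quotalg *:%R to_quot
  to_quot_is_scalable.

End QuotientAlgebra.

(* The algebra K[M] of a (possibly infinite) monoid M; [<< m >>] is the basis
   element m.  The ring structure that monalg puts on {malg K[M]} requires 1 to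
   be the only invertible element of M, so it is not available for groups. *)
Section LinearExtension.
Variables (K : fieldType) (M : choiceType).

Definition mlift (N : lmodType K) (f : M -> N) (x : {malg K[M]}) : N :=
  \sum_(k <- msupp x) x@_k *: f k.

Variables (N : lmodType K) (f : M -> N).

Lemma mliftEw (d : {fset M}) (x : {malg K[M]}) : (msupp x `<=` d)%fset ->
  mlift f x = \sum_(k <- d) x@_k *: f k.
Proof.
move=> xd; rewrite /mlift; apply: big_fset_incl => // k _ /mcoeff_outdom ->.
by rewrite scale0r.
Qed.

Lemma mlift_is_linear : linear (mlift f).
Proof.
move=> a x y; pose d := (msupp (a *: x + y) `|` (msupp x `|` msupp y))%fset.
rewrite (@mliftEw d) ?fsubsetUl // (@mliftEw d x); last first.
  by rewrite /d fsetUCA fsubsetUl.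
rewrite (@mliftEw d y); last by rewrite /d fsetUA fsubsetUr.
rewrite scaler_sumr -big_split /=; apply: eq_bigr => k _.
by rewrite mcoeffD mcoeffZ scalerDl scalerA.
Qed.

HB.instance Definition _ :=
  GRing.isLinear.Build K {malg K[M]} N *:%R (mlift f) mlift_is_linear.

Lemma mliftU k : mlift f << k >> = f k.
Proof. by rewrite /mlift msuppU oner_eq0 big_seq_fset1 mcoeffUU scale1r. Qed.

Lemma malg_lin_ind (P : {malg K[M]} -> Prop) :
  P 0 -> (forall c k x, P x -> P (c *: << k >> + x)) -> forall x, P x.
Proof.
move=> P0 PD x; rewrite [x]monalgE; elim: (enum_fset _) => [|k s IH].
  by rewrite big_nil.
rewrite big_cons; suff -> : << x@_k *g k >> = x@_k *: << k >> by apply: PD.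
by apply/malgP => k'; rewrite mcoeffZ !mcoeffU mulrnAr mulr1.
Qed.

Lemma malg_lin_ext (g1 g2 : {linear {malg K[M]} -> N}) :
  (forall k, g1 << k >> = g2 << k >>) -> forall x, g1 x = g2 x.
Proof.
move=> e x; elim/malg_lin_ind: x => [|c k x IH]; first by rewrite !linear0.
by rewrite !linearP e IH.
Qed.

Lemma mliftDf (f1 f2 : M -> N) a x :
  mlift (fun k => a *: f1 k + f2 k) x = a *: mlift f1 x + mlift f2 x.
Proof.
rewrite /mlift scaler_sumr -big_split /=; apply: eq_bigr => k _.
by rewrite scalerDr !scalerA mulrC.
Qed.

End LinearExtension.

Lemma mlift_comp (K : fieldType) (M : choiceType) (N N' : lmodType K)
    (f : M -> N) (g : {linear N -> N'}) x :
  g (mlift f x) = mlift (fun k => g (f k)) x.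
Proof.
by rewrite /mlift linear_sum; apply: eq_bigr => k _; rewrite linearZ.
Qed.

Definition monoid_alg (K : fieldType) (M : monoidType) : Type := {malg K[M]}.

HB.instance Definition _ (K : fieldType) (M : monoidType) :=
  GRing.Lmodule.copy (monoid_alg K M) {malg K[M]}.

(* Locked, like the product below: otherwise unification tries to compute with
   finitely supported functions. *)
HB.lock Definition mbase (K : fieldType) (M : monoidType) (m : M) :
  monoid_alg K M := << m >>.
Canonical mbase_unlockable := Unlockable mbase.unlock.
Arguments mbase {K M} m.

HB.lock Definition monoid_alg_mul (K : fieldType) (M : monoidType)
    (x y : monoid_alg K M) : monoid_alg K M :=
  mlift (fun a => mlift (fun b => mbase (a * b)%g) y) x.
Canonical monoid_alg_mul_unlockable := Unlockable monoid_alg_mul.unlock.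
Arguments monoid_alg_mul {K M} x y.

Section MonoidAlgebra.
Variables (K : fieldType) (M : monoidType).
Local Notation KM := (monoid_alg K M).

Lemma mliftE (N : lmodType K) (f : M -> N) (m : M) :
  mlift f (mbase m : KM) = f m.
Proof. by rewrite unlock mliftU. Qed.

Lemma monoid_alg_ind (P : KM -> Prop) :
  P 0 -> (forall c m x, P x -> P (c *: mbase m + x)) -> forall x, P x.
Proof. by rewrite unlock; apply: malg_lin_ind. Qed.

Lemma monoid_alg_mulE (x y : KM) :
  monoid_alg_mul x y = mlift (fun a => mlift (fun b => mbase (a * b)%g) y) x.
Proof. by rewrite unlock. Qed.

Lemma monoid_alg_mulPl (y : KM) a (x x' : KM) :
  monoid_alg_mul (a *: x + x') y = a *: monoid_alg_mul x y + monoid_alg_mul x' y.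
Proof. by rewrite !monoid_alg_mulE linearP. Qed.

Lemma monoid_alg_mulPr (x : KM) a (y y' : KM) :
  monoid_alg_mul x (a *: y + y') = a *: monoid_alg_mul x y + monoid_alg_mul x y'.
Proof.
rewrite !monoid_alg_mulE -mliftDf.
by congr mlift; apply/funext => m; rewrite linearP.
Qed.

Lemma monoid_alg_mulU (a b : M) :
  monoid_alg_mul (mbase a : KM) (mbase b) = mbase (a * b)%g.
Proof. by rewrite !monoid_alg_mulE !mliftE. Qed.

Lemma monoid_alg_mul0l (y : KM) : monoid_alg_mul 0 y = 0.
Proof. by rewrite !monoid_alg_mulE linear0. Qed.

Lemma monoid_alg_mul0r (x : KM) : monoid_alg_mul x 0 = 0.
Proof. by have := monoid_alg_mulPr x (-1) 0 0; rewrite !scaleN1r !addNr. Qed.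

Lemma monoid_alg_mulA : associative (@monoid_alg_mul K M).
Proof.
move=> x y z; elim/monoid_alg_ind: x => [|c a x IH].
  by rewrite !monoid_alg_mul0l.
rewrite 3!monoid_alg_mulPl IH; congr (c *: _ + _) => {x IH}.
elim/monoid_alg_ind: y => [|c' b y IH].
  by rewrite monoid_alg_mul0l monoid_alg_mul0r monoid_alg_mul0l.
rewrite monoid_alg_mulPl 2!monoid_alg_mulPr monoid_alg_mulPl IH.
congr (c' *: _ + _) => {y IH}.
elim/monoid_alg_ind: z => [|d m z IH]; first by rewrite !monoid_alg_mul0r.
by rewrite 3!monoid_alg_mulPr IH !monoid_alg_mulU mulgA.
Qed.

Lemma monoid_alg_mul1 : left_id (mbase 1%g) (@monoid_alg_mul K M).
Proof.
elim/monoid_alg_ind=> [|d m z IH]; first by rewrite monoid_alg_mul0r.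
by rewrite monoid_alg_mulPr IH monoid_alg_mulU mul1g.
Qed.

Lemma monoid_alg_1mul : right_id (mbase 1%g) (@monoid_alg_mul K M).
Proof.
elim/monoid_alg_ind=> [|d m z IH]; first by rewrite monoid_alg_mul0l.
by rewrite monoid_alg_mulPl IH monoid_alg_mulU mulg1.
Qed.

Lemma monoid_alg_mulDl : left_distributive (@monoid_alg_mul K M) +%R.
Proof.
by move=> x y z; have := monoid_alg_mulPl z 1 x y; rewrite !scale1r.
Qed.

Lemma monoid_alg_mulDr : right_distributive (@monoid_alg_mul K M) +%R.
Proof.
by move=> x y z; have := monoid_alg_mulPr x 1 y z; rewrite !scale1r.
Qed.

Lemma mbase1_neq0 : mbase 1%g != 0 :> KM.
Proof.
by rewrite unlock; apply/eqP => /malgP /(_ 1%g) /eqP; rewrite mcoeffUU mcoeff0 oner_eq0.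
Qed.

HB.instance Definition _ := GRing.Zmodule_isNzRing.Build KM
  monoid_alg_mulA monoid_alg_mul1 monoid_alg_1mul
  monoid_alg_mulDl monoid_alg_mulDr mbase1_neq0.

Lemma monoid_alg_scalerAl (k : K) (x y : KM) : k *: (x * y) = (k *: x) * y.
Proof.
by have := monoid_alg_mulPl y k x 0; rewrite monoid_alg_mul0l !addr0 => /esym.
Qed.

Lemma monoid_alg_scalerAr (k : K) (x y : KM) : k *: (x * y) = x * (k *: y).
Proof.
by have := monoid_alg_mulPr x k y 0; rewrite monoid_alg_mul0r !addr0 => /esym.
Qed.

HB.instance Definition _ :=
  GRing.Lmodule_isLalgebra.Build K KM monoid_alg_scalerAl.
HB.instance Definition _ :=
  GRing.Lalgebra_isAlgebra.Build K KM monoid_alg_scalerAr.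

Lemma mbaseM (a b : M) : mbase a * mbase b = mbase (a * b)%g :> KM.
Proof. exact: monoid_alg_mulU. Qed.

Lemma mbase1 : mbase 1%g = 1 :> KM.
Proof. by []. Qed.

End MonoidAlgebra.

Section Bimodules.
Variables (K : fieldType) (R : algType K).

(* Linearity over K of both actions, for the single K-structure of the carrier,
   says that K acts centrally. *)
Record bimodule := Bimodule {
  bimod_sort :> lmodType K;
  lscal : R -> bimod_sort -> bimod_sort;
  rscal : bimod_sort -> R -> bimod_sort;
  lscalP : forall r (a : K) x y, lscal r (a *: x + y) = a *: lscal r x + lscal r y;
  lscalPl : forall x (a : K) r s, lscal (a *: r + s) x = a *: lscal r x + lscal s x;
  lscal1 : forall x, lscal 1 x = x;
  lscalM : forall r s x, lscal (r * s) x = lscal r (lscal s x);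
  rscalP : forall r (a : K) x y, rscal (a *: x + y) r = a *: rscal x r + rscal y r;
  rscalPr : forall x (a : K) r s, rscal x (a *: r + s) = a *: rscal x r + rscal x s;
  rscal1 : forall x, rscal x 1 = x;
  rscalM : forall r s x, rscal x (r * s) = rscal (rscal x r) s;
  lrscalA : forall r x s, rscal (lscal r x) s = lscal r (rscal x s)
}.

End Bimodules.

(* The tensor algebra T_R(L).

   The word (l_1 ... l_m, r) stands for the pure tensor
   l_1 (x)_R ... (x)_R l_m (x)_R r of L (x)_R ... (x)_R L (x)_R R, which is
   L^{(x)_R m}, and R itself when m = 0.  Words form a monoid under
   concatenation of pure tensors, (s, r)(y s', r') = (s (r y) s', r').
   The direct sum over m of the L^{(x)_R m} is the free K-module on words modulo
   the span of the relations of multilinearity and R-balancedness, each of which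
   involves words of a single length m. *)
Section TensorAlgebra.
Variables (K : fieldType) (R : algType K) (L : bimodule R).

Definition tword : Type := (seq L * R)%type.

HB.instance Definition _ := Choice.on tword.

Definition tword_one : tword := ([::], 1).
Definition tword_mul (u v : tword) : tword :=
  if v.1 is y :: s then (u.1 ++ lscal u.2 y :: s, v.2) else (u.1, u.2 * v.2).

Lemma tword_mulA : associative tword_mul.
Proof.
case=> [s r] [[|y s'] r'] [[|z s''] r''] //; rewrite /tword_mul /=.
- by rewrite mulrA.
- by rewrite lscalM.
- by rewrite -catA.
Qed.

Lemma tword_mul1 : left_id tword_one tword_mul.
Proof. by case=> [[|y s] r]; rewrite /tword_mul /= ?mul1r ?lscal1. Qed.

Lemma tword_1mul : right_id tword_one tword_mul.
Proof. by case=> [s r]; rewrite /tword_mul /= mulr1. Qed.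

HB.instance Definition _ := isMonoid.Build tword tword_mulA tword_mul1 tword_1mul.

Local Notation KW := (monoid_alg K tword).
Local Notation pure s r := (mbase ((s, r) : tword) : KW).

Inductive tensor_rel : KW -> Prop :=
| tensor_linear_slot (s : seq L) (a : K) (x y : L) (s' : seq L) (r : R) :
    tensor_rel (pure (s ++ (a *: x + y) :: s') r
      - a *: pure (s ++ x :: s') r - pure (s ++ y :: s') r)
| tensor_linear_last (s : seq L) (a : K) (r r' : R) :
    tensor_rel (pure s (a *: r + r') - a *: pure s r - pure s r')
| tensor_balanced_slot (s : seq L) (x : L) (t : R) (y : L) (s' : seq L) (r : R) :
    tensor_rel (pure (s ++ rscal x t :: y :: s') r
      - pure (s ++ x :: lscal t y :: s') r)
| tensor_balanced_last (s : seq L) (x : L) (t r : R) :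
    tensor_rel (pure (s ++ [:: rscal x t]) r - pure (s ++ [:: x]) (t * r)).

Let pureM0 s r r' : pure s r * pure [::] r' = pure s (r * r').
Proof. by rewrite mbaseM. Qed.

Let pureM s r y s' r' : pure s r * pure (y :: s') r' = pure (s ++ lscal r y :: s') r'.
Proof. by rewrite mbaseM. Qed.

Lemma tensor_relMl (u : tword) x : tensor_rel x -> tensor_rel (mbase u * x).
Proof.
case: u => [s0 r0]; case=> {x}.
- move=> s a x y s' r; rewrite !mulrBr -scalerAr.
  case: s => [|z s]; rewrite ?cat0s ?cat_cons !pureM.
    by rewrite lscalP; apply: tensor_linear_slot.
  by rewrite -!cat_cons !catA; apply: tensor_linear_slot.
- move=> s a r r'; rewrite !mulrBr -scalerAr.
  case: s => [|z s]; rewrite ?pureM0 ?pureM; last exact: tensor_linear_last.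
  by rewrite mulrDr -scalerAr; apply: tensor_linear_last.
- move=> s x t y s' r; rewrite !mulrBr.
  case: s => [|z s]; rewrite ?cat0s ?cat_cons !pureM.
    by rewrite -lrscalA; apply: tensor_balanced_slot.
  by rewrite -!cat_cons !catA; apply: tensor_balanced_slot.
- move=> s x t r; rewrite !mulrBr.
  case: s => [|z s]; rewrite ?cat0s ?cat_cons !pureM.
    by rewrite -lrscalA; apply: tensor_balanced_last.
  by rewrite -!cat_cons !catA; apply: tensor_balanced_last.
Qed.

Lemma tensor_relMr (u : tword) x : tensor_rel x -> tensor_rel (x * mbase u).
Proof.
case: u => [s0 r0]; case=> {x}.
- move=> s a x y s' r; rewrite !mulrBl -scalerAl.
  case: s0 => [|z s0]; rewrite ?pureM0 ?pureM; first exact: tensor_linear_slot.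
  by rewrite -!catA !cat_cons; apply: tensor_linear_slot.
- move=> s a r r'; rewrite !mulrBl -scalerAl.
  case: s0 => [|z s0]; rewrite ?pureM0 ?pureM.
    by rewrite mulrDl -scalerAl; apply: tensor_linear_last.
  by rewrite lscalPl; apply: tensor_linear_slot.
- move=> s x t y s' r; rewrite !mulrBl.
  case: s0 => [|z s0]; rewrite ?pureM0 ?pureM; first exact: tensor_balanced_slot.
  by rewrite -!catA !cat_cons; apply: tensor_balanced_slot.
- move=> s x t r; rewrite !mulrBl.
  case: s0 => [|z s0]; rewrite ?pureM0 ?pureM.
    by rewrite -mulrA; apply: tensor_balanced_last.
  by rewrite lscalM -!catA /=; apply: tensor_balanced_slot.
Qed.

Lemma tensor_spanMl a x : lspan tensor_rel x -> lspan tensor_rel (a * x).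
Proof.
move=> Sx; elim/monoid_alg_ind: a => [|c u a IH].
  by rewrite mul0r; apply: lspan0.
rewrite mulrDl -scalerAl; apply: lspanD => //; apply: lspanZ.
elim: Sx {IH} => [|b y z Sy _ IH]; first by rewrite mulr0; apply: lspan0.
by rewrite mulrDr -scalerAr; apply: lspanZD => //; apply: tensor_relMl.
Qed.

Lemma tensor_spanMr a x : lspan tensor_rel x -> lspan tensor_rel (x * a).
Proof.
move=> Sx; elim/monoid_alg_ind: a => [|c u a IH].
  by rewrite mulr0; apply: lspan0.
rewrite mulrDr -scalerAr; apply: lspanD => //; apply: lspanZ.
elim: Sx {IH} => [|b y z Sy _ IH]; first by rewrite mul0r; apply: lspan0.
by rewrite mulrDl -scalerAl; apply: lspanZD => //; apply: tensor_relMr.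
Qed.

(* The projection onto the component L^{(x)_R 0} = R, an algebra morphism. *)
Definition word_aug (w : tword) : R := if w.1 is [::] then w.2 else 0.
Definition aug : KW -> R := mlift word_aug.
HB.instance Definition _ := GRing.Linear.on aug.

Lemma augU w : aug (mbase w) = word_aug w.
Proof. exact: mliftE. Qed.

Let augP a x y : aug (a *: x + y) = a *: aug x + aug y.
Proof. exact: linearP. Qed.

Let aug_0 : aug 0 = 0. Proof. exact: linear0. Qed.

Let augB x y : aug (x - y) = aug x - aug y. Proof. exact: linearB. Qed.

Let augZ a x : aug (a *: x) = a *: aug x. Proof. exact: linearZ. Qed.

Lemma augM x y : aug (x * y) = aug x * aug y.
Proof.
elim/monoid_alg_ind: x => [|a u x IH]; first by rewrite mul0r aug_0 mul0r.
rewrite mulrDl -scalerAl 2!augP IH mulrDl -scalerAl; congr (a *: _ + _) => {IH}.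
elim/monoid_alg_ind: y => [|b v y IH]; first by rewrite mulr0 aug_0 mulr0.
rewrite mulrDr -scalerAr 2!augP IH mulrDr -scalerAr; congr (b *: _ + _).
case: u v {IH} => s r [[|z' s'] r'].
  by rewrite pureM0 !augU; case: s => //= ? ?; rewrite mul0r.
by rewrite pureM !augU; case: s => [|? ?]; rewrite /word_aug /= mulr0.
Qed.

Lemma aug_tensor_span x : lspan tensor_rel x -> aug x = 0.
Proof.
elim=> [|a y z Sy _ IH]; first exact: aug_0.
rewrite augP IH addr0; case: Sy => {y z IH}.
- move=> s b x0 y s' r; rewrite !augB augZ !augU.
  by case: s => [|? ?]; rewrite /word_aug /= scaler0 !subr0 scaler0.
- move=> s b r r'; rewrite !augB augZ !augU.
  case: s => [|? ?]; rewrite /word_aug /= ?scaler0 ?subr0 ?scaler0 //.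
  by rewrite [_ + r']addrC addrK subrr scaler0.
- move=> s x0 t y s' r; rewrite augB !augU.
  by case: s => [|? ?]; rewrite /word_aug /= subr0 scaler0.
- move=> s x0 t r; rewrite augB !augU.
  by case: s => [|? ?]; rewrite /word_aug /= subr0 scaler0.
Qed.

Lemma tensor_span1 : ~ lspan tensor_rel 1.
Proof.
move/aug_tensor_span; rewrite -[1]/(pure [::] 1) augU => /eqP.
by rewrite oner_eq0.
Qed.

Definition tensor_ideal : ideal KW :=
  Ideal (lspan0 tensor_rel) tensor_span1 (@lspanD _ _ tensor_rel)
    tensor_spanMl tensor_spanMr.

Definition tensor_alg := quotalg tensor_ideal.

HB.instance Definition _ := GRing.Algebra.on tensor_alg.

Definition tens (s : seq L) (r : R) : tensor_alg :=
  to_quot tensor_ideal (pure s r).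

(* The inclusions of R = L^{(x)_R 0} and L = L^{(x)_R 1}.  The product
   [tens1 u * tens1 v] is u (x)_R v. *)
Definition tens0 (r : R) : tensor_alg := tens [::] r.
Definition tens1 (l : L) : tensor_alg := tens [:: l] 1.

Definition tensor_aug (t : tensor_alg) : R := aug (qrepr t).

Lemma tensor_augE w : tensor_aug (to_quot tensor_ideal w) = aug w.
Proof.
apply/eqP; rewrite -subr_eq0 -linearB; apply/eqP/aug_tensor_span.
exact: (@qrepr_ideal _ _ tensor_ideal).
Qed.

Lemma tensor_aug_linear : linear tensor_aug.
Proof.
move=> a p q; rewrite -[p]qreprK -[q]qreprK -linearP !tensor_augE.
by rewrite linearP.
Qed.

HB.instance Definition _ :=
  GRing.isLinear.Build K tensor_alg R *:%R tensor_aug tensor_aug_linear.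

Lemma tensor_augM p q : tensor_aug (p * q) = tensor_aug p * tensor_aug q.
Proof. by rewrite -[p]qreprK -[q]qreprK -rmorphM !tensor_augE augM. Qed.

Lemma tensor_aug1 l : tensor_aug (tens1 l) = 0.
Proof. by rewrite tensor_augE augU. Qed.

Lemma tensor_aug0 r : tensor_aug (tens0 r) = r.
Proof. by rewrite tensor_augE augU. Qed.

End TensorAlgebra.

Arguments tens0 {K R} L r.

Section TensorTheory.
Variables (K : fieldType) (R : algType K) (L : bimodule R).

Lemma tens1_l r (l : L) : tens0 L r * tens1 l = tens1 (lscal r l).
Proof. by rewrite /tens0 /tens1 /tens -rmorphM mbaseM. Qed.
Lemma tens1_r r (l : L) : tens1 l * tens0 L r = tens1 (rscal l r).
Proof.
rewrite /tens0 /tens1 /tens -rmorphM mbaseM; apply/esym/to_quot_eq.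
rewrite (_ : (_ * _)%g = ([:: l], r * 1) :> tword L); last first.
  by rewrite mulr1; congr pair; rewrite /= mul1r.
exact: lspan_in (tensor_balanced_last [::] l r 1).
Qed.
Lemma tens0M r s : tens0 L r * tens0 L s = tens0 L (r * s).
Proof. by rewrite /tens0 /tens -rmorphM mbaseM. Qed.
Lemma tens1Z a (l : L) : tens1 (a *: l) = a *: tens1 l.
Proof.
have P x y : tens1 (a *: x + y) = a *: tens1 x + tens1 y :> tensor_alg L.
  rewrite /tens1 /tens -linearP; apply/to_quot_eq; rewrite opprD addrA.
  exact: lspan_in (tensor_linear_slot [::] a x y [::] 1).
have Z : tens1 (0 : L) = 0.
  have := lspan_in (tensor_linear_slot [::] 1 (0:L) 0 [::] 1).
  rewrite !cat0s !scale1r addr0 subrr sub0r => h.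
  rewrite /tens1 /tens -(raddf0 (to_quot (tensor_ideal L))); apply/to_quot_eq.
  by rewrite subr0 -[mbase _]opprK -scaleN1r; apply: lspanZ.
by have := P l 0; rewrite !addr0 Z addr0.
Qed.
End TensorTheory.

(* Gradings by an abelian group A, here written additively: [D a x] says that x
   is in the degree a component. *)
Section Gradings.
Variables (K : fieldType) (A : zmodType).

Record grading (M : lmodType K) (D : A -> M -> Prop) : Prop := {
  grading0 : forall a, D a 0;
  gradingP : forall a (k : K) x y, D a x -> D a y -> D a (k *: x + y);
  grading_sum : forall x, exists (s : seq A) (f : A -> M),
    (forall a, D a (f a)) /\ x = \sum_(a <- s) f a;
  grading_direct : forall (s : seq A) (f : A -> M), uniq s ->
    (forall a, D a (f a)) -> \sum_(a <- s) f a = 0 ->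
    forall a, a \in s -> f a = 0
}.

Lemma grading_uniq (M : lmodType K) (D : A -> M -> Prop) c d x :
  grading D -> D c x -> D d x -> x != 0 -> c = d.
Proof.
move=> gD Dc Dd; apply: contra_neq_eq => cd.
pose f e := if e == c then x else if e == d then - x else 0.
have := @grading_direct _ _ gD [:: c; d] f _ _ _ c (mem_head _ _).
rewrite {3}/f eqxx; apply.
- by rewrite /= inE cd.
- move=> e; rewrite /f; case: eqP => [->//|_]; case: eqP => [->|_]; last exact: grading0.
  by rewrite -scaleN1r -[_ *: _]addr0; apply: gradingP => //; apply: grading0.
by rewrite !big_cons big_nil /f eqxx eq_sym (negbTE cd) eqxx addr0 subrr.
Qed.

Record graded_algebra (R : algType K) (D : A -> R -> Prop) : Prop := {
  galg_grading : grading D;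
  galg_mul : forall a b x y, D a x -> D b y -> D (a + b) (x * y)
}.

Record graded_bimodule (R : algType K) (DR : A -> R -> Prop)
    (L : bimodule R) (DL : A -> L -> Prop) : Prop := {
  gbimod_grading : grading DL;
  gbimod_act : forall a b c r x s, DR a r -> DL b x -> DR c s ->
    DL (a + b + c) (rscal (lscal r x) s)
}.

Record bicharacter (eps : A -> A -> K) : Prop := {
  bichar_neq0 : forall a b, eps a b != 0;
  bicharDr : forall a b c, eps a (b + c) = eps a b * eps a c;
  bicharDl : forall a b c, eps (a + b) c = eps a c * eps b c
}.

Definition antisymmetric_bichar (eps : A -> A -> K) : Prop :=
  forall a b, eps b a = (eps a b)^-1.

End Gradings.

(* Identities required of homogeneous
   elements are quantified over membership in the graded components; they hold
   trivially as soon as one of the elements is 0, whatever its degree. *)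
Section ColorLieRings.
Variables (K : fieldType) (A : zmodType) (eps : A -> A -> K).
Variables (R : algType K) (DR : A -> R -> Prop).
Variables (L : bimodule R) (DL : A -> L -> Prop) (br : L -> L -> L).

Record color_lie_ring : Prop := {
  clr_graded : graded_bimodule DR DL;
  clr_linl : forall (k : K) x x' y, br (k *: x + x') y = k *: br x y + br x' y;
  clr_linr : forall (k : K) x y y', br x (k *: y + y') = k *: br x y + br x y';
  clr_bilinear : forall r s x y, br (lscal r x) (rscal y s) = lscal r (rscal (br x y) s);
  clr_balanced : forall r x y, br (rscal x r) y = br x (lscal r y);
  clr_degree : forall a b x y, DL a x -> DL b y -> DL (a + b) (br x y);
  clr_antisym : forall a b x y, DL a x -> DL b y ->
    br x y = - (eps a b *: br y x);
  clr_jacobi : forall a b c x y z, DL a x -> DL b y -> DL c z ->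
    eps c a *: br x (br y z) + eps a b *: br y (br z x)
      + eps b c *: br z (br x y) = 0
}.

Inductive uenv_rel : tensor_alg L -> Prop :=
| Uenv_rel a b u v : DL a u -> DL b v ->
    uenv_rel (tens1 u * tens1 v - eps a b *: (tens1 v * tens1 u)
                - tens1 (br u v)).

(* The ideal J is proper: it is killed by the projection of T_R(L) onto R. *)
Lemma aug_uenv_ideal x : ideal_gen uenv_rel x -> tensor_aug x = 0.
Proof.
elim=> [{}x [a b u v _ _]||y z _ Iy _ Iz|a y _ Iy|a y _ Iy].
- by rewrite !linearB linearZ /= !tensor_augM !tensor_aug1 mulr0 scaler0 !subr0.
- by rewrite linear0.
- by rewrite linearD /= Iy Iz addr0.
- by rewrite tensor_augM Iy mulr0.
- by rewrite tensor_augM Iy mul0r.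
Qed.

Lemma uenv_ideal_proper : ~ ideal_gen uenv_rel 1.
Proof.
move/aug_uenv_ideal; have -> : (1 : tensor_alg L) = tens0 L 1 by [].
by rewrite tensor_aug0 => /eqP; rewrite oner_eq0.
Qed.

Definition uenv_ideal : ideal (tensor_alg L) :=
  generated_ideal uenv_ideal_proper.

Definition uenv := quotalg uenv_ideal.

HB.instance Definition _ := GRing.Algebra.on uenv.

Definition to_uenv : tensor_alg L -> uenv :=
  @to_quot K (tensor_alg L) uenv_ideal.

HB.instance Definition _ := GRing.LRMorphism.on to_uenv.

End ColorLieRings.

(* The bimodule V (x) KG, realized as the space of functions f : G -> V, with f
   standing for the sum over g in G of f(g) (x) g. *)
Section SmashBimodule.
Variables (K : fieldType) (gT : finGroupType) (V : vectType K).

Local Notation KG := (monoid_alg K gT).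

Record linear_action := LinearAction {
  lin_act :> gT -> 'End(V);
  lin_act1 : lin_act 1%g = \1%VF;
  lin_actM : forall g h, lin_act (g * h)%g = (lin_act g \o lin_act h)%VF
}.

Variable rho : linear_action.

Definition vtens (v : V) (g : gT) : {ffun gT -> V} :=
  [ffun h => if h == g then v else 0].

Definition smash_lmul (g : gT) (f : {ffun gT -> V}) : {ffun gT -> V} :=
  [ffun h => rho g (f (g^-1 * h)%g)].
Definition smash_rmul (f : {ffun gT -> V}) (g : gT) : {ffun gT -> V} :=
  [ffun h => f (h * g^-1)%g].

Definition smash_lact (r : KG) (f : {ffun gT -> V}) : {ffun gT -> V} :=
  mlift (smash_lmul^~ f) r.
Definition smash_ract (f : {ffun gT -> V}) (r : KG) : {ffun gT -> V} :=
  mlift (smash_rmul f) r.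

Lemma smash_lmulP g : linear (smash_lmul g).
Proof. by move=> a x y; apply/ffunP => h; rewrite !ffunE linearP. Qed.

Lemma smash_rmulP g : linear (smash_rmul^~ g).
Proof. by move=> a x y; apply/ffunP => h; rewrite !ffunE. Qed.

Lemma smash_lactP r a x y :
  smash_lact r (a *: x + y) = a *: smash_lact r x + smash_lact r y.
Proof.
rewrite /smash_lact -mliftDf; congr mlift.
by apply/funext => g; rewrite smash_lmulP.
Qed.

Lemma smash_ractP r a x y :
  smash_ract (a *: x + y) r = a *: smash_ract x r + smash_ract y r.
Proof.
rewrite /smash_ract -mliftDf; congr mlift.
by apply/funext => g; rewrite smash_rmulP.
Qed.

Lemma smash_lactPl x a r s :
  smash_lact (a *: r + s) x = a *: smash_lact r x + smash_lact s x.
Proof. by rewrite /smash_lact linearP. Qed.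

Lemma smash_ractPr x a r s :
  smash_ract x (a *: r + s) = a *: smash_ract x r + smash_ract x s.
Proof. by rewrite /smash_ract linearP. Qed.

Lemma smash_lactU g x : smash_lact (mbase g) x = smash_lmul g x.
Proof. exact: mliftE. Qed.

Lemma smash_ractU g x : smash_ract x (mbase g) = smash_rmul x g.
Proof. exact: mliftE. Qed.

Let lact0r x : smash_lact 0 x = 0. Proof. exact: linear0. Qed.
Let ractr0 x : smash_ract x 0 = 0. Proof. exact: linear0. Qed.
Let lactr0 r : smash_lact r 0 = 0.
Proof. by have := smash_lactP r (-1) 0 0; rewrite !scaleN1r !addNr. Qed.
Let ract0r r : smash_ract 0 r = 0.
Proof. by have := smash_ractP r (-1) 0 0; rewrite !scaleN1r !addNr. Qed.

Lemma smash_lact1 x : smash_lact 1 x = x.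
Proof.
rewrite -mbase1 smash_lactU; apply/ffunP => h.
by rewrite ffunE lin_act1 lfunE /= invg1 mul1g.
Qed.

Lemma smash_ract1 x : smash_ract x 1 = x.
Proof.
by rewrite -mbase1 smash_ractU; apply/ffunP => h; rewrite ffunE invg1 mulg1.
Qed.

Lemma smash_lactM r s x : smash_lact (r * s) x = smash_lact r (smash_lact s x).
Proof.
elim/monoid_alg_ind: r => [|a g r IH]; first by rewrite mul0r !lact0r.
rewrite mulrDl -scalerAl !smash_lactPl IH; congr (a *: _ + _) => {IH}.
elim/monoid_alg_ind: s => [|b h s IH]; first by rewrite mulr0 !lact0r lactr0.
rewrite mulrDr -scalerAr !smash_lactPl IH smash_lactP.
congr (b *: _ + _); rewrite mbaseM !smash_lactU; apply/ffunP => k.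
by rewrite !ffunE lin_actM lfunE /= invMg mulgA.
Qed.

Lemma smash_ractM r s x : smash_ract x (r * s) = smash_ract (smash_ract x r) s.
Proof.
elim/monoid_alg_ind: r => [|a g r IH]; first by rewrite mul0r ractr0 ract0r.
rewrite mulrDl -scalerAl !smash_ractPr IH smash_ractP.
congr (a *: _ + _) => {IH}.
elim/monoid_alg_ind: s => [|b h s IH]; first by rewrite mulr0 !ractr0.
rewrite mulrDr -scalerAr !smash_ractPr IH.
congr (b *: _ + _); rewrite mbaseM !smash_ractU; apply/ffunP => k.
by rewrite !ffunE invMg mulgA.
Qed.

Lemma smash_lractA r x s :
  smash_ract (smash_lact r x) s = smash_lact r (smash_ract x s).
Proof.
elim/monoid_alg_ind: r => [|a g r IH]; first by rewrite !lact0r ract0r.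
rewrite !smash_lactPl smash_ractP IH; congr (a *: _ + _) => {IH}.
elim/monoid_alg_ind: s => [|b h s IH]; first by rewrite !ractr0 lactr0.
rewrite !smash_ractPr smash_lactP IH; congr (b *: _ + _).
by rewrite !(smash_lactU, smash_ractU); apply/ffunP => k; rewrite !ffunE mulgA.
Qed.

Definition smash_bimod : bimodule KG :=
  @Bimodule K KG {ffun gT -> V} smash_lact smash_ract
    smash_lactP smash_lactPl smash_lact1 smash_lactM
    smash_ractP smash_ractPr smash_ract1 smash_ractM smash_lractA.

Lemma smash_bimodE g v h g' :
  rscal (lscal (mbase g) (vtens v h : smash_bimod)) (mbase g')
    = vtens (rho g v) (g * h * g')%g.
Proof.
rewrite /lscal /rscal /= smash_lactU smash_ractU; apply/ffunP => k; rewrite !ffunE.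
rewrite (can2_eq (mulKVg g) (mulKg g)) (can2_eq (mulgKV g') (mulgK g')).
by case: ifP => // _; rewrite linear0.
Qed.

End SmashBimodule.

Section YetterDrinfeld.
Variables (K : fieldType) (gT : finGroupType) (V : vectType K).
Variable rho : linear_action gT V.
Variables (A : zmodType) (eps : A -> A -> K).
Variable DG : A -> monoid_alg K gT -> Prop.
Variable DL : A -> smash_bimod rho -> Prop.
Variable br : smash_bimod rho -> smash_bimod rho -> smash_bimod rho.

Definition group_homogeneous : Prop := forall g : gT, exists a, DG a (mbase g).

Record yetter_drinfeld (DV : A -> V -> Prop) : Prop := {
  yd_grading : grading DV;
  yd_induced : forall a b v (g : gT), DV a v -> DG b (mbase g) ->
    DL (a + b) (vtens v g);
  yd_action : forall a b v (g : gT), DV a v -> DG b (mbase g) ->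
    rho g v = eps b a *: v
}.

Definition purely_positive (DV : A -> V -> Prop) : Prop :=
  forall a v, DV a v -> v != 0 -> eps a a = 1.

(* eps(|g|, |h|) = 1 for all g, h in G, unless V = 0.

   Without it the monomials need not be independent: for v in V homogeneous with
   eps(|v|, |v|) = 1, taking v (x) g and v (x) h in the relations of U(L) gives
   eps(|g|, |v|) (1 - eps(|g|, |h|)) v^2 gh = 0.  For instance, take V = K in
   degree 0 with trivial action and zero bracket, A = G = (Z/2)^2 with
   |g| = g, and eps(a, b) = (-1)^(a_1 b_2 - a_2 b_1): then v^2 = 0 in U(L).
   [pbw_basis_group_trivial] below shows that the condition is necessary. *)
Definition trivial_on_group : Prop := (fullv : {vspace V}) != 0%VS ->
  forall a b (g h : gT), DG a (mbase g) -> DG b (mbase h) -> eps a b = 1.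

(* The image of v_1^m_1 ... v_n^m_n g in U(L); v_i is v_i (x) 1_G in L. *)
Definition pbw_monomial n (v : n.-tuple V) (mg : {ffun 'I_n -> nat} * gT) :
    uenv eps DL br :=
  (\prod_(i < n) to_uenv eps DL br (tens1 (vtens (tnth v i) 1%g : smash_bimod rho))
      ^+ mg.1 i)
  * to_uenv eps DL br (tens0 (smash_bimod rho) (mbase mg.2)).

End YetterDrinfeld.

Arguments trivial_on_group {K gT} V {A} eps DG.

Lemma twisted_comm_eq0 (K : fieldType) (B : algType K) (x gg gh gk : B) (e1 e2 e3 : K) :
  gg * x = e1 *: (x * gg) -> gh * x = e2 *: (x * gh) -> gg * gh = gk ->
  gh * gg = gk -> x * gg * (x * gh) = e3 *: (x * gh * (x * gg)) ->
  (e1 - e3 * e2) *: (x * x * gk) = 0.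
Proof.
move=> h1 h2 h3 h4; rewrite -!mulrA [gg * _]mulrA h1 [gh * (x * _)]mulrA h2.
rewrite -!scalerAl -!scalerAr -!mulrA h3 h4 scalerA => e.
by rewrite scalerBl -e subrr.
Qed.

Lemma pbw_basis_group_trivial
  (K : fieldType) (K_char0 : [pchar K] =i pred0)
  (gT : finGroupType) (G_abelian : abelian [set: gT])
  (V : vectType K) (rho : linear_action gT V)
  (A : zmodType) (eps : A -> A -> K)
  (eps_bichar : bicharacter eps) (eps_antisym : antisymmetric_bichar eps)
  (DG : A -> monoid_alg K gT -> Prop) (DG_graded : graded_algebra DG)
  (G_homogeneous : group_homogeneous DG)
  (DL : A -> smash_bimod rho -> Prop)
  (br : smash_bimod rho -> smash_bimod rho -> smash_bimod rho)
  (L_color : color_lie_ring eps DG DL br)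
  (DV : A -> V -> Prop) (L_YD : yetter_drinfeld eps DG DL DV)
  (L_pos : purely_positive eps DV)
  (n : nat) (v : n.-tuple V) (v_basis : basis_of fullv v)
  (v_homogeneous : forall i, exists a, DV a (tnth v i)) :
  is_basis (@pbw_monomial K gT V rho A eps DL br n v) ->
  trivial_on_group V eps DG.
Proof.
move=> [_ free] V0 b c g h Dg Dh.
have n0 : (0 < n)%N.
  rewrite lt0n; apply: contra V0 => /eqP n0.
  by rewrite -dimv_eq0 (size_basis v_basis) n0.
pose i0 := Ordinal n0; have [a Da] := v_homogeneous i0.
set w := tnth v i0 in Da.
have w0 : w != 0 by apply: (free_not0 (basis_free v_basis)); exact: mem_tnth.
have eaa := L_pos _ _ Da w0.
have D1 : DG 0 (mbase 1%g).
  have [d Dd] := G_homogeneous 1%g.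
  suff d0 : d = 0 by rewrite -d0.
  have Ddd := galg_mul DG_graded Dd Dd; rewrite mbaseM mulg1 in Ddd.
  have := grading_uniq (galg_grading DG_graded) Dd Ddd (mbase1_neq0 _ _).
  by move/(congr1 (+%R^~ (- d))); rewrite /= subrr addrK.
pose L := smash_bimod rho.
pose u : L := vtens w 1%g.
have DLu : DL a u by rewrite -[a]addr0; apply: (yd_induced L_YD).
have eu k : vtens w k = rscal u (mbase k) :> L.
  rewrite /rscal /= smash_ractU; apply/ffunP => x; rewrite !ffunE.
  by rewrite -[1%g](mulgV k) (inj_eq (mulIg _)).
have ue d k : DG d (mbase k) -> lscal (mbase k) u = eps d a *: rscal u (mbase k) :> L.
  move=> Dk; rewrite -eu /lscal /= smash_lactU; apply/ffunP => x; rewrite !ffunE.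
  rewrite -[1%g](mulVg k) (inj_eq (mulgI _)).
  by case: ifP => _; rewrite ?linear0 ?scaler0 // (yd_action L_YD Da Dk).
have bru : br u u = 0.
  have := clr_antisym L_color DLu DLu; rewrite eaa scale1r => /eqP.
  rewrite -addr_eq0 -mulr2n -scaler_nat scaler_eq0 => /orP[|/eqP//].
  by rewrite -(negbK (_ == 0)) (_ : 2%:R != 0 :> K) //; have /pcharf0P -> := K_char0.
have br0l y : br 0 y = 0.
  by have := clr_linl L_color (-1) 0 0 y; rewrite !scaleN1r !addNr.
have brZ k x y : br x (k *: y) = k *: br x y.
  have z : br x 0 = 0.
    by have := clr_linr L_color (-1) x 0 0; rewrite !scaleN1r !addNr.
  by have := clr_linr L_color k x y 0; rewrite !addr0 z addr0.
have rs0 r : rscal (0 : L) r = 0.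
  by have := rscalP r (-1) (0:L) 0; rewrite !scaleN1r !addNr.
have ls0 r : lscal r (0 : L) = 0.
  by have := lscalP r (-1) (0:L) 0; rewrite !scaleN1r !addNr.
have brgh : br (vtens w g : L) (vtens w h : L) = 0.
  rewrite !eu (clr_balanced L_color) -lrscalA (ue _ _ Dg).
  have -> : rscal (eps b a *: rscal u (mbase g)) (mbase h)
     = eps b a *: rscal u (mbase (g * h)%g) :> L.
    have := rscalP (mbase h) (eps b a) (rscal u (mbase g)) (0 : L).
    by rewrite !addr0 rs0 addr0 => ->; rewrite -rscalM mbaseM.
  rewrite brZ -[X in br X]lscal1 (clr_bilinear L_color) bru rs0 ls0.
  by rewrite scaler0.
pose U := to_uenv eps DL br.
pose X (l : L) := U (tens1 l).
pose G k := U (tens0 L (mbase k)).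
have Xr k : X (vtens w k) = X u * G k.
  by rewrite /X /G /U eu -tens1_r rmorphM.
have GX d k : DG d (mbase k) -> G k * X u = eps d a *: (X u * G k).
  move=> Dk; rewrite /G /X /U -rmorphM tens1_l (ue _ _ Dk) tens1Z /= linearZZ /=.
  by rewrite -tens1_r rmorphM.
have GG k l : G k * G l = G (k * l)%g by rewrite /G /U -rmorphM tens0M mbaseM.
have rel : X (vtens w g) * X (vtens w h)
   = eps (a + b) (a + c) *: (X (vtens w h) * X (vtens w g)).
  apply/eqP; rewrite -subr_eq0; apply/eqP.
  have := @Uenv_rel _ _ eps _ L DL br _ _ _ _
    (yd_induced L_YD Da Dg) (yd_induced L_YD Da Dh).
  move/ideal_gen_in => h0.
  have t0 : tens1 (0 : L) = 0 by rewrite -(scale0r (0 : L)) tens1Z scale0r.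
  rewrite brgh t0 subr0 in h0.
  have : U (tens1 (vtens w g : L) * tens1 (vtens w h : L) - eps (a + b) (a + c) *:
     (tens1 (vtens w h : L) * tens1 (vtens w g : L))) = 0.
    rewrite -[RHS](linear0 (to_uenv eps DL br)).
    have [_ q] := @to_quot_eq K (tensor_alg L) (uenv_ideal eps DL br)
      (tens1 (vtens w g : L) * tens1 (vtens w h : L) - eps (a + b) (a + c) *:
     (tens1 (vtens w h : L) * tens1 (vtens w g : L))) 0.
    by apply: q; rewrite subr0.
  by rewrite /U linearB /= linearZZ /= !rmorphM.
have P : (eps b a * (1 - eps b c)) *: (X u * X u * G (g * h)%g) = 0.
  have hg : (h * g)%g = (g * h)%g by apply: (centsP G_abelian); rewrite inE.
  have := @twisted_comm_eq0 K (uenv eps DL br) (X u) (G g) (G h) (G (g * h)%g)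
    (eps b a) (eps c a)
    (eps (a + b) (a + c)) (GX _ _ Dg) (GX _ _ Dh) (GG g h).
  rewrite GG hg -!Xr => /(_ erefl rel).
  suff -> : eps b a - eps (a + b) (a + c) * eps c a = eps b a * (1 - eps b c) by [].
  rewrite (bicharDl eps_bichar) !(bicharDr eps_bichar) eaa mul1r.
  rewrite (eps_antisym a c) mulrBr mulr1; congr (_ - _).
  by rewrite mulrAC mulfV ?mul1r ?(bichar_neq0 eps_bichar).
pose m : {ffun 'I_n -> nat} := [ffun i => if i == i0 then 2 else 0]%N.
have Pm : pbw_monomial eps DL br v (m, (g * h)%g) = X u * X u * G (g * h)%g.
  rewrite /pbw_monomial /=; congr (_ * _).
  rewrite (big_only1 i0) //= => [|j ji _]; rewrite ffunE ?eqxx ?expr2 //.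
  by rewrite (negbTE ji) expr0.
have := free [:: (m, (g * h)%g)] (fun=> eps b a * (1 - eps b c)) isT.
rewrite big_seq1 Pm P => /(_ erefl _ (mem_head _ _)) /eqP.
by rewrite mulf_eq0 (negbTE (bichar_neq0 eps_bichar _ _)) subr_eq0 => /eqP.
Qed.

(* Main.v *)
Require Import Defs.
From HB Require Import structures.
From mathcomp Require Import all_boot all_order all_fingroup all_algebra.
From mathcomp Require Import ssrAC ring finmap monalg.
From mathcomp Require boolp.

(* As in the classical theorem, U(L) is made to act on the free module P with
   basis the symbols z_(m, g), in such a way that the monomial
   v_1^m_1 ... v_n^m_n g sends z_(0, 1) to z_(m, g); this gives independence.
   The operator x_i of v_i is defined by induction on the degree: if j < i is the
   least index of m and z_m = x_j z_m', then
   x_i z_m = eps(|v_i|, |v_j|) x_j x_i z_m' + [v_i, v_j] z_m'.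
   The relation x_i x_j = eps(|v_i|, |v_j|) x_j x_i + [v_i, v_j] then holds on all
   of P by induction on the degree, the Jacobi identity resolving the overlap
   x_i x_j x_k with k < j < i.  Since eps is trivial on the degrees of the elements
   of G, an element of G commutes with [v_i, v_j] up to the same factor as with
   v_i v_j, and the relations extend from V to L.  Conversely psi : P -> U(L), sending
   z_(m, g) to the corresponding monomial, intertwines the two actions, so
   u = u psi(z_(0, 1)) = psi(u z_(0, 1)), which gives generation. *)

Set Implicit Arguments.
Unset Strict Implicit.
Unset Printing Implicit Defensive.

Import GRing.Theory.
Local Open Scope ring_scope.

(** * Exponent vectors *)

Section Exponents.
Variable n : nat.
Local Notation mon := {ffun 'I_n -> nat}.
Implicit Types (i j : 'I_n) (m : mon).

Definition mdeg m : nat := (\sum_i m i)%N.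
Definition mincr i m : mon := [ffun j => (m j + (j == i))%N].
Definition mdecr i m : mon := [ffun j => (m j - (j == i))%N].
(** The condition under which x_i z_m is already an ordered monomial. *)
Definition mabove i m : bool := [forall j : 'I_n, (j < i)%N ==> (m j == 0%N)].

Lemma maboveP i m : reflect (forall j, (j < i)%N -> m j = 0%N) (mabove i m).
Proof.
apply: (iffP forallP) => [h j ji|h j]; first by apply/eqP; have := h j; rewrite ji.
by apply/implyP => /h ->.
Qed.

Lemma mincrK i : cancel (mincr i) (mdecr i).
Proof. by move=> m; apply/ffunP => j; rewrite !ffunE addnK. Qed.

Lemma mdecrK i m : (0 < m i)%N -> mincr i (mdecr i m) = m.
Proof.
by move=> mi; apply/ffunP => j; rewrite !ffunE; case: eqP => [->|_]; rewrite ?subnK // subn0 addn0.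
Qed.

Lemma mincrC i j m : mincr i (mincr j m) = mincr j (mincr i m).
Proof. by apply/ffunP => k; rewrite !ffunE addnAC. Qed.

Lemma mdeg_incr i m : mdeg (mincr i m) = (mdeg m).+1.
Proof.
rewrite /mdeg; under eq_bigr do rewrite ffunE.
by rewrite big_split /= -big_mkcond sum1_card card1 addn1.
Qed.

Lemma mabove_incr i j m : (j <= i)%N -> mabove j m -> mabove j (mincr i m).
Proof.
move=> ji /maboveP h; apply/maboveP => k kj; rewrite ffunE h //.
by case: eqP => // ki; rewrite -ki leqNgt kj in ji.
Qed.

(** The two cases in the definition of x_i z_m. In the second one, j is the least index of m, since
    [mabove j m']. *)
Variant mon_spec i m : Prop :=
| MonAbove of mabove i m
| MonIncr j m' of m = mincr j m' & (j < i)%N & mabove j m'.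

(** A computable form of [mon_spec], on which the recursion [xlower] can branch. The three
    conditions determine j, so the choice made by [pick] is harmless. *)
Definition mfirst i m : option 'I_n :=
  [pick j : 'I_n | [&& (j < i)%N, (0 < m j)%N & mabove j m]].

Lemma mfirst_above i m : mabove i m -> mfirst i m = None.
Proof.
move/maboveP => h; rewrite /mfirst; case: pickP => // j /and3P[ji mj _].
by rewrite h in mj.
Qed.

Lemma mfirst_incr i j m : (j < i)%N -> mabove j m -> mfirst i (mincr j m) = Some j.
Proof.
move=> ji h; rewrite /mfirst; case: pickP => [k /and3P[ki mk /maboveP hk]|/(_ j)].
  congr Some; apply/val_inj/eqP; rewrite eqn_leq; apply/andP; split; rewrite leqNgt; apply/negP.
    by move/hk; rewrite ffunE eqxx addn1.
  by move=> kj; move/maboveP: (mabove_incr (leqnn j) h) mk => /(_ _ kj) ->.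
by rewrite ji mabove_incr // ffunE eqxx addn1.
Qed.

Lemma monP i m : mon_spec i m.
Proof.
case: (boolP (mabove i m)) => [|/forallPn/= [k]]; first exact: MonAbove.
rewrite negb_imply -lt0n => /andP[ki mk].
case: (@arg_minnP _ k (fun k => 0 < m k)%N val mk) => j mj hj.
have jm : mabove j m.
  apply/maboveP => l lj; apply/eqP; rewrite -leqn0 leqNgt; apply/negP => /hj.
  by rewrite leqNgt lj.
apply: (@MonIncr _ _ j (mdecr j m)); rewrite ?mdecrK //.
  exact: leq_ltn_trans (hj _ mk) ki.
by apply/maboveP => l lj; rewrite ffunE (maboveP _ _ jm).
Qed.

Lemma mdeg0 m : mdeg m = 0%N -> m = [ffun => 0%N].
Proof.
move/eqP; rewrite /mdeg sum_nat_eq0 => /forallP h; apply/ffunP => i.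
by rewrite ffunE; apply/eqP; exact: h.
Qed.

Lemma enum_sorted : sorted (fun i j : 'I_n => (i < j)%N) (enum 'I_n).
Proof. by have := iota_ltn_sorted 0 n; rewrite -val_enum_ord sorted_map. Qed.

End Exponents.

(** * Free modules, accessed only through linear extension and the basis property *)

Record free_module (K : fieldType) (I : choiceType) := FreeModule {
  fm_sort :> lmodType K;
  fm_base : I -> fm_sort;
  fm_lift : forall N : lmodType K, (I -> N) -> fm_sort -> N;
  fm_lift_linear : forall (N : lmodType K) (f : I -> N), linear (fm_lift f);
  fm_lift_base : forall (N : lmodType K) (f : I -> N) q, fm_lift f (fm_base q) = f q;
  fm_span : forall x, exists (s : seq I) (a : I -> K), x = \sum_(q <- s) a q *: fm_base q;
  fm_free : forall (s : seq I) (a : I -> K), uniq s ->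
    \sum_(q <- s) a q *: fm_base q = 0 -> forall q, q \in s -> a q = 0
}.
Arguments fm_base {K I} _ q.
Arguments fm_lift {K I} _ {N} _ x.

HB.instance Definition _ (K : fieldType) (I : choiceType) (P : free_module K I)
    (N : lmodType K) (f : I -> N) :=
  GRing.isLinear.Build K P N *:%R (fm_lift P f) (@fm_lift_linear K I P N f).

Lemma fm_ind (K : fieldType) (I : choiceType) (P : free_module K I) (S : P -> Prop) :
  S 0 -> (forall a q x, S x -> S (a *: fm_base P q + x)) -> forall x, S x.
Proof.
move=> S0 SD x; have [s [a ->]] := fm_span x.
by elim: s => [|q s IH]; rewrite ?big_nil ?big_cons //; apply: SD.
Qed.

(* Opaque, so that unification never computes with finitely supported functions. *)
Definition free_module_of (K : fieldType) (I : choiceType) : free_module K I.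
Proof.
apply: (@FreeModule K I {malg K[I]} (fun q => << q >>) (fun N f x => mlift f x)).
- by move=> N f; exact: mlift_is_linear.
- by move=> N f q; rewrite mliftU.
- move=> x; exists (msupp x), (fun q => x@_q); rewrite [LHS]monalgE.
  apply: eq_bigr => q _; apply/malgP => q'.
  by rewrite mcoeffZ !mcoeffU mulrnAr mulr1.
move=> s a us h q qs.
have := congr1 (mcoeff q) h; rewrite mcoeff0 raddf_sum (big_rem q) //=.
rewrite [X in X + _]mcoeffZ mcoeffUU mulr1 big_seq big1 ?addr0 // => r.
rewrite mem_rem_uniq // inE => /andP[/negbTE rq _].
by rewrite mcoeffZ mcoeffU rq mulr0.
Qed.

(** * The action on the span of the ordered monomials *)

Section PbwModule.
Variables (K : fieldType) (gT : finGroupType) (n : nat).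
Local Notation mon := {ffun 'I_n -> nat}.
Local Notation L := {ffun 'I_n * gT -> K^o}.
Variable P : free_module K (mon * gT)%type.
Local Notation zmon := (@fm_base _ _ P).
Local Notation zlift := (@fm_lift _ _ P (fm_sort P)).

Variables (e : 'I_n -> 'I_n -> K) (chi : gT -> 'I_n -> K) (c : 'I_n -> 'I_n -> L).
Implicit Types (i j k : 'I_n) (m : mon) (g h : gT) (q : mon * gT)
  (x y : P) (l : L) (a : K) (d : nat).

(** The scalar produced by moving x_i to its place in the ordered monomial, past the powers of the
    x_j with j < i. *)
Definition lead i m : K := \prod_(j < n | (j < i)%N) e i j ^+ m j.
(** The scalar produced by moving g from the left to the right of the monomial. *)
Definition mchi g m : K := \prod_(j < n) chi g j ^+ m j.

Lemma lead_above i m : mabove i m -> lead i m = 1.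
Proof. by move/maboveP => h; rewrite /lead big1 // => j /h ->. Qed.

Lemma lead_incr i j m : (j < i)%N -> lead i (mincr j m) = e i j * lead i m.
Proof.
move=> ji; rewrite /lead (bigD1 j) //= [in RHS](bigD1 j) //= ffunE eqxx addn1 exprS mulrA.
by congr (_ * _); apply: eq_bigr => k /andP[_ /negbTE kj]; rewrite ffunE kj addn0.
Qed.

Lemma mchi_incr g j m : mchi g (mincr j m) = chi g j * mchi g m.
Proof.
rewrite /mchi (bigD1 j) //= [in RHS](bigD1 j) //= ffunE eqxx addn1 exprS mulrA.
by congr (_ * _); apply: eq_bigr => k /negbTE kj; rewrite ffunE kj addn0.
Qed.

Definition grpact g : P -> P := zlift (fun q => mchi g q.1 *: zmon (q.1, (g * q.2)%g) : P).
HB.instance Definition _ g := GRing.Linear.on (grpact g).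

Lemma grpactE g m h : grpact g (zmon (m, h)) = mchi g m *: zmon (m, (g * h)%g).
Proof. exact: fm_lift_base. Qed.

(* With d at least the degree of m, the terms of x_i z_(m, g) other than its
   leading term: x_i z_m = e_ij x_j (x_i z_m') + [x_i, x_j] z_m' when
   z_m = x_j z_m' with j < i the least index of m. *)
Fixpoint xlower d i (q : mon * gT) : P :=
  if d isn't d'.+1 then 0 else
  if mfirst i q.1 isn't Some j then 0 else
  let X k := zlift (fun r => lead k r.1 *: zmon (mincr k r.1, r.2) + xlower d' k r : P) in
  let q' := (mdecr j q.1, q.2) in
  e i j *: X j (xlower d' i q') + \sum_p c i j p *: X p.1 (grpact p.2 (zmon q')).

Definition xterm d i (q : mon * gT) : P :=
  lead i q.1 *: zmon (mincr i q.1, q.2) + xlower d i q.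

Definition xact i : P -> P := zlift (fun q => xterm (mdeg q.1) i q).
HB.instance Definition _ i := GRing.Linear.on (xact i).

(** In U(L) the element v_k (x) g is the product v_k g, so it acts as x_k after g. Here [l] is a
    vector of coordinates in the basis v_k (x) g. *)
Definition lact (l : L) (x : P) : P := \sum_p l p *: xact p.1 (grpact p.2 x).

Lemma lact_linear l : linear (lact l).
Proof.
move=> a x y; rewrite /lact scaler_sumr -big_split; apply: eq_bigr => p _ /=.
by rewrite !linearP.
Qed.
HB.instance Definition _ l := GRing.isLinear.Build K P P *:%R (lact l) (lact_linear l).

Lemma lactPl a l l' x : lact (a *: l + l') x = a *: lact l x + lact l' x.
Proof.
rewrite /lact scaler_sumr -big_split; apply: eq_bigr => p _ /=.
by rewrite !ffunE scalerDl scalerA.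
Qed.

(** * The degree filtration of P *)

Definition degle d : P -> Prop :=
  lspan (fun x => exists2 q, (mdeg q.1 <= d)%N & x = zmon q).

Lemma degleD d x y : degle d x -> degle d y -> degle d (x + y).
Proof. exact: lspanD. Qed.
Lemma degleZ d a x : degle d x -> degle d (a *: x).
Proof. exact: lspanZ. Qed.
Lemma degle0 d : degle d 0. Proof. exact: lspan0. Qed.
Lemma degle_zmon d q : (mdeg q.1 <= d)%N -> degle d (zmon q).
Proof. by move=> h; apply: lspan_in; exists q. Qed.
Lemma degle_sum d (I : finType) (f : I -> P) :
  (forall t, degle d (f t)) -> degle d (\sum_t f t).
Proof. by move=> h; apply: big_ind => //; [apply: degle0|apply: degleD]. Qed.
Lemma degleW d d' x : (d <= d')%N -> degle d x -> degle d' x.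
Proof.
move=> dd; elim=> [|a y z [q qd ->] _]; first exact: degle0.
by apply/degleD/degleZ/degle_zmon/(leq_trans qd).
Qed.

Lemma degle_zlift d d' (f : mon * gT -> P) :
  (forall q, (mdeg q.1 <= d)%N -> degle d' (f q)) ->
  forall x, degle d x -> degle d' (zlift f x).
Proof.
move=> h x; elim=> [|a y z [q qd ->] _ IH]; first by rewrite linear0; apply: degle0.
by rewrite linearP /= fm_lift_base; apply/degleD/IH/degleZ/h.
Qed.

Lemma degle_zlift_eq d (f f' : mon * gT -> P) :
  (forall q, (mdeg q.1 <= d)%N -> f q = f' q) ->
  forall x, degle d x -> zlift f x = zlift f' x.
Proof.
move=> h x; elim=> [|a y z [q qd ->] _ IH]; first by rewrite !linear0.
by rewrite !linearP /= IH !fm_lift_base h.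
Qed.

Lemma degle_grpact g d x : degle d x -> degle d (grpact g x).
Proof. by apply: degle_zlift => q qd; apply/degleZ/degle_zmon. Qed.

Lemma xlower_above d i m g : mabove i m -> xlower d i (m, g) = 0.
Proof. by case: d => //= d /mfirst_above ->. Qed.

Lemma xlower_incr d i j m g : (j < i)%N -> mabove j m ->
  xlower d.+1 i (mincr j m, g) = e i j *: zlift (xterm d j) (xlower d i (m, g))
    + \sum_p c i j p *: zlift (xterm d p.1) (grpact p.2 (zmon (m, g))).
Proof. by move=> ji h; rewrite /= mfirst_incr // mincrK. Qed.

Lemma degle_xterm_aux d i q :
  degle (mdeg q.1) (xlower d i q) -> degle (mdeg q.1).+1 (xterm d i q).
Proof.
move=> h; apply: degleD; first by apply/degleZ/degle_zmon; rewrite mdeg_incr.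
by apply: degleW h.
Qed.

(** Every term of the recursion applies a single x_k to something of degree at most deg m - 1. Hence
    x_i raises the degree only through its leading term. *)
Lemma degle_xlower d i q : degle (mdeg q.1) (xlower d i q).
Proof.
elim: d i q => [|d IH] i [m g]; first exact: degle0.
case: (monP i m) => [h|j m' -> ji h]; first by rewrite xlower_above //; apply: degle0.
rewrite xlower_incr // mdeg_incr.
have X k x : degle (mdeg m') x -> degle (mdeg m').+1 (zlift (xterm d k) x).
  apply: degle_zlift => q qd; apply: (@degleW (mdeg q.1).+1) => //.
  exact: degle_xterm_aux.
apply: degleD; first by apply/degleZ/X; exact: (IH i (m', g)).
by apply: degle_sum => p; apply/degleZ/X/degle_grpact/degle_zmon.
Qed.

(** By [degle_xlower] the recursive calls only meet monomials of degree at most deg m - 1, so fuel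
    beyond the degree changes nothing. *)
Lemma xlowerS d i q : (mdeg q.1 <= d)%N -> xlower d.+1 i q = xlower d i q.
Proof.
elim: d i q => [|d IH] i [m g].
  rewrite leqn0 => /eqP /mdeg0 /= ->.
  by rewrite mfirst_above //; apply/maboveP => j _; rewrite ffunE.
case: (monP i m) => [h|j m' -> ji h]; first by rewrite !xlower_above.
rewrite mdeg_incr ltnS => hm; rewrite !xlower_incr //.
have X k x : degle (mdeg m') x -> zlift (xterm d.+1 k) x = zlift (xterm d k) x.
  apply: degle_zlift_eq => q qd; rewrite /xterm IH //.
  exact: leq_trans qd hm.
rewrite IH // X; last exact: (degle_xlower d i (m', g)).
congr (_ + _); apply: eq_bigr => p _; rewrite X //.
exact/degle_grpact/degle_zmon.
Qed.

Lemma xterm_deg d i q : (mdeg q.1 <= d)%N -> xterm d i q = xact i (zmon q).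
Proof.
move=> h; rewrite /xact fm_lift_base /xterm; congr (_ + _).
rewrite -(subnK h); elim: (_ - _)%N => // k IH.
by rewrite addSn xlowerS // leq_addl.
Qed.

(** Used when x_i z_m has too high a degree for an induction hypothesis: the leading term is then
    treated directly, and only y by induction. *)
Lemma xact_lead i m g : exists2 y, degle (mdeg m) y &
  xact i (zmon (m, g)) = lead i m *: zmon (mincr i m, g) + y.
Proof.
exists (xlower (mdeg m) i (m, g)); first exact: (degle_xlower _ i (m, g)).
exact: fm_lift_base.
Qed.

Lemma xact_above i m g : mabove i m -> xact i (zmon (m, g)) = zmon (mincr i m, g).
Proof.
move=> h; rewrite /xact fm_lift_base /xterm lead_above // scale1r.
by rewrite xlower_above // addr0.
Qed.

(** The recursive rule freed of fuel, the only form in which it is used below. *)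
Lemma xact_incr i j m g : (j < i)%N -> mabove j m ->
  xact i (zmon (mincr j m, g))
  = e i j *: xact j (xact i (zmon (m, g))) + lact (c i j) (zmon (m, g)).
Proof.
move=> ji h; rewrite {1 3}/xact !fm_lift_base /xterm mdeg_incr xlower_incr //=.
have X k x : degle (mdeg m) x -> zlift (xterm (mdeg m) k) x = xact k x.
  by apply: degle_zlift_eq => q qd; rewrite xterm_deg // /xact fm_lift_base.
(* As j lies below i and is at most every index of m, x_j sends the leading term of x_i z_m to an
   ordered monomial, which is the leading term on the left. *)
rewrite linearP /= xact_above ?mabove_incr 1?ltnW // scalerDr scalerA lead_incr //.
rewrite mincrC addrA X; last exact: (degle_xlower _ i (m, g)).
congr (_ + _); apply: eq_bigr => p _; rewrite X //.
exact/degle_grpact/degle_zmon.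
Qed.

(** Right multiplication by h on V (x) KG, in coordinates. *)
Definition lrmul l h : L := [ffun p => l (p.1, (p.2 * h^-1)%g)].
(** The map [v_i, -] in coordinates, as [v_i, v_k (x) g] = [v_i, v_k] g. *)
Definition ladj i l : L := \sum_p l p *: lrmul (c i p.1) p.2.

(* [chi g i] is eps(|g|, |v_i|) and [e i j] is eps(|v_i|, |v_j|); [c i j] is the
   bracket of v_i and v_j in the basis v_k (x) g. *)
Record color_constants : Prop := {
  cc_group : commutative (@mulg gT);
  cc_e1 : forall i, e i i = 1;
  cc_eV : forall i j, e i j * e j i = 1;
  cc_chi_neq0 : forall g i, chi g i != 0;
  cc_chiM : forall g h i, chi (g * h)%g i = chi g i * chi h i;
  cc_c1 : forall i, c i i = 0;
  cc_cC : forall i j, c j i = - e j i *: c i j;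
  cc_chi : forall g i j p, c i j p != 0 -> chi g p.1 = chi g i * chi g j;
  cc_e : forall k i j p, c i j p != 0 -> e k p.1 = e k i * e k j * chi p.2 k;
  cc_jacobi : forall i j k,
    ladj i (c j k) + (e j k * e i k) *: ladj k (c i j) = e i j *: ladj j (c i k)
}.

Hypothesis cc : color_constants.

(** * Commutation of the group elements with the operators x_i *)

Lemma grpactM g h x : grpact g (grpact h x) = grpact (g * h)%g x.
Proof.
elim/fm_ind: x => [|a [m t] x IH]; first by rewrite !linear0.
rewrite !linearP /= IH; congr (_ *: _ + _).
rewrite !grpactE linearZ /= grpactE scalerA mulgA; congr (_ *: _).
by rewrite /mchi -big_split; apply: eq_bigr => i _; rewrite (cc_chiM cc) exprMn mulrC.
Qed.

Lemma grpactC g h x : grpact g (grpact h x) = grpact h (grpact g x).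
Proof. by rewrite !grpactM (cc_group cc). Qed.

Definition grpact_comm d := forall i g x, degle d x ->
  grpact g (xact i x) = chi g i *: xact i (grpact g x).

(** By [cc_chi], each v_k (x) h occurring in [v_i, v_j] commutes with g up to one common factor,
    that of v_i v_j. *)
Lemma grpact_lact_deg d : grpact_comm d -> forall g i j x, degle d x ->
  grpact g (lact (c i j) x) = (chi g i * chi g j) *: lact (c i j) (grpact g x).
Proof.
move=> IH g i j x dx; rewrite /lact linear_sum scaler_sumr; apply: eq_bigr => p _ /=.
rewrite linearZ /= IH; last exact: degle_grpact.
rewrite grpactC !scalerA; have [->|cp] := eqVneq (c i j p) 0; first by rewrite mul0r mulr0 !scale0r.
by rewrite -(cc_chi cc g cp) mulrC.
Qed.

(** Induction along [xact_incr]: moving g past x_j x_i z_m' and past [v_i, v_j] z_m' gives the same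
    factor, by [grpact_lact_deg]. *)
Lemma grpact_xact_deg d : grpact_comm d.
Proof.
elim: d => [|d IH] i g x.
all: elim=> [|a y z [[m h] md ->] _ IHx]; rewrite ?linear0 ?scaler0 //.
all: rewrite !linearP /= IHx; congr (_ *: _ + _).
all: have A j m' t : mabove j m' ->
  grpact g (xact j (zmon (m', t))) = chi g j *: xact j (grpact g (zmon (m', t)));
  first by move=> mj; rewrite xact_above // !grpactE linearZ /= xact_above // scalerA mchi_incr.
all: case: (monP i m) md => [im|j m' -> ji jm'] /=; first by rewrite A.
  by rewrite mdeg_incr.
rewrite mdeg_incr ltnS => md.
have dz : degle d (zmon (m', h)) by apply: degle_zmon.
rewrite grpactE linearZ /= !xact_incr // linearP /= (grpact_lact_deg IH) //.
have -> : grpact g (xact j (xact i (zmon (m', h))))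
    = chi g j *: xact j (grpact g (xact i (zmon (m', h)))).
  (* The degree of x_i z_m' may exceed d. Its leading term is ordered under x_j, which [A] handles;
     the induction hypothesis handles the rest. *)
  have [w dw ->] := xact_lead i m' h.
  rewrite !linearP /= A ?mabove_incr 1?ltnW // IH //; exact: degleW dw.
rewrite IH // !grpactE !linearZ /= !scalerDr !scalerA mchi_incr.
by congr (_ *: _ + _ *: _); ring.
Qed.

Lemma grpact_xact i g x : grpact g (xact i x) = chi g i *: xact i (grpact g x).
Proof.
elim/fm_ind: x => [|a q x IH]; first by rewrite !linear0.
rewrite !linearP /= IH; congr (_ *: _ + _).
exact/grpact_xact_deg/degle_zmon/leqnn.
Qed.

Lemma xact_grpact i g x : xact i (grpact g x) = (chi g i)^-1 *: grpact g (xact i x).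
Proof. by rewrite grpact_xact scalerK // (cc_chi_neq0 cc). Qed.

Lemma lact0 x : lact 0 x = 0.
Proof. by rewrite /lact big1 // => p _; rewrite ffunE scale0r. Qed.

Lemma lactZ a l x : lact (a *: l) x = a *: lact l x.
Proof. by rewrite -[a *: l]addr0 lactPl lact0 addr0. Qed.

Lemma lactD l l' x : lact (l + l') x = lact l x + lact l' x.
Proof. by rewrite -[l]scale1r lactPl !scale1r. Qed.

Lemma lact_lrmul l g x : lact (lrmul l g) x = lact l (grpact g x).
Proof.
rewrite /lact (reindex (fun p => (p.1, (p.2 * g)%g))) /=; last first.
  by exists (fun p => (p.1, (p.2 * g^-1)%g)) => -[i h] _ /=; rewrite ?mulgK ?mulgKV.
by apply: eq_bigr => -[i h] _; rewrite ffunE /= mulgK grpactM.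
Qed.

Lemma lact_ladj i l x : lact (ladj i l) x = \sum_p l p *: lact (c i p.1) (grpact p.2 x).
Proof.
rewrite /ladj (big_morph (lact^~ x) (fun l l' => lactD l l' x) (lact0 x)).
by apply: eq_bigr => p _; rewrite lactZ lact_lrmul.
Qed.

(** * The bracket relation between x_i and x_j on P *)

Definition xact_comm i j x :=
  xact i (xact j x) = e i j *: xact j (xact i x) + lact (c i j) x.

(** Moving x_i past a term v_l (x) g of [v_j, v_k] costs eps(|v_i|, |v_l|) and the inverse of
    chi_g(i); by [cc_e] the product is the same for all terms. The correction terms add up to [v_i,
    [v_j, v_k]]. *)
Lemma xact_lact i j k x : (forall p, xact_comm i p.1 (grpact p.2 x)) ->
  xact i (lact (c j k) x)
  = (e i j * e i k) *: lact (c j k) (xact i x) + lact (ladj i (c j k)) x.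
Proof.
move=> h; rewrite lact_ladj /lact linear_sum scaler_sumr -big_split.
apply: eq_bigr => p _ /=; rewrite linearZ /= h scalerDr; congr (_ + _).
have [->|cp] := eqVneq (c j k p) 0; first by rewrite !scale0r scaler0.
have -> : xact p.1 (xact i (grpact p.2 x))
    = (chi p.2 i)^-1 *: xact p.1 (grpact p.2 (xact i x)) by rewrite xact_grpact linearZ.
rewrite !scalerA (cc_e cc i cp); congr (_ *: _).
by field; apply: (cc_chi_neq0 cc).
Qed.

Lemma xact_comm_sym i j x : xact_comm i j x -> xact_comm j i x.
Proof.
rewrite /xact_comm => ->; rewrite (cc_cC cc i j) lactZ scalerDr scalerA (cc_eV cc) scale1r.
by rewrite scaleNr addrK.
Qed.

Lemma xact_comm_linear i j a x y :
  xact_comm i j x -> xact_comm i j y -> xact_comm i j (a *: x + y).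
Proof.
move=> hx hy; rewrite /xact_comm !linearP /= hx hy.
by rewrite scalerDr addrACA.
Qed.

(** Here x_j z_m is ordered, and the relation is the recursive rule itself. *)
Lemma xact_comm_above i j m g : (j < i)%N -> mabove j m -> xact_comm i j (zmon (m, g)).
Proof. by move=> ji h; rewrite /xact_comm xact_above // xact_incr. Qed.

(** The leading term of x_k z_m falls under [xact_comm_above]; the remainder has degree at most deg
    m. *)
Lemma xact_comm_lead i j k m g : (j < i)%N -> (j < k)%N -> mabove j m ->
  (forall y, degle (mdeg m) y -> xact_comm i j y) ->
  xact_comm i j (xact k (zmon (m, g))).
Proof.
move=> ji jk jm h; have [y dy ->] := xact_lead k m g.
apply: xact_comm_linear; last exact: h.
by apply: xact_comm_above => //; apply: mabove_incr => //; apply: ltnW.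
Qed.

(** Resolution of the overlap x_i x_j x_k: both sides are expanded with x_k leftmost, and the double
    brackets left over cancel by the Jacobi identity. *)
Lemma xact_comm_deg d i j x : degle d x -> xact_comm i j x.
Proof.
elim: d i j x => [|d IH] i j x.
all: elim=> [|a y z [[m g] md ->] _ IHz]; first by rewrite /xact_comm !linear0 addr0.
all: apply: xact_comm_linear => // {IHz}.
(* The relation is symmetric in i and j by [xact_comm_sym], and trivial for i = j because e_ii = 1
   and [v_i, v_i] = 0. *)
all: wlog ji : i j / (j < i)%N => [hw|]; first (
  case: (ltngtP i j) => [/hw/xact_comm_sym|/hw|/val_inj ->] //;
  by rewrite /xact_comm (cc_e1 cc) scale1r (cc_c1 cc) lact0 addr0).
all: case: (monP j m) md => [jm|k m' -> kj km'] /=; first by move=> _; apply: xact_comm_above.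
  by rewrite mdeg_incr.
(* From here z_m = x_k u with k < j < i and u of degree at most d. *)
rewrite mdeg_incr ltnS => md; rewrite -xact_above //; set u := zmon _.
have du : degle d u by apply: degle_zmon.
have ki := ltn_trans kj ji.
have IHy i' j' y' : degle (mdeg m') y' -> xact_comm i' j' y' by move=> h; apply/IH/degleW/h.
have E1 : xact_comm j k u by apply: IH.
(* In [E2] and [E5] the vectors x_j u and x_i u may have degree d + 1, out of reach of [IH];
   [xact_comm_lead] applies because k is at most every index of u. *)
have E2 : xact_comm i k (xact j u) by apply: xact_comm_lead => // *; apply: IHy.
have E3 : xact_comm i j u by apply: IH.
have E4 : xact_comm i k u by apply: IH.
have E5 : xact_comm j k (xact i u) by apply: xact_comm_lead => // *; apply: IHy.
have A i' j' k' := @xact_lact i' j' k' u (fun p => IH _ _ _ (degle_grpact p.2 du)).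
rewrite /xact_comm in E1 E2 E3 E4 E5 *.
rewrite E1 linearP /= E2 E3 E4 !linearP /= E5 !A.
have J : lact (ladj i (c j k)) u + (e j k * e i k) *: lact (ladj k (c i j)) u
   = e i j *: lact (ladj j (c i k)) u.
  by rewrite -lactZ -lactD (cc_jacobi cc) lactZ.
move: J; move: (xact k _) (lact (ladj i _) u) (lact (ladj j _) u) (lact (ladj k _) u).
move=> W Ji Jj Jk J.
rewrite !scalerDr -J !scalerA.
(* The factors from moving x_i and x_j past x_k cancel those from moving x_k past [v_i, v_j]. *)
have -> : e i k * e j k * (e k i * e k j) = 1 by rewrite mulrACA !(cc_eV cc) mulr1.
rewrite [e i j * (_ * _)]mulrA (cc_eV cc) mul1r scale1r [e i k * e i j]mulrC [e j k * e i k]mulrC.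
by rewrite !addrA [RHS](+%R.[ACl 1*6*5*3*2*4]).
Qed.

Lemma xact_commE i j x : xact_comm i j x.
Proof.
elim/fm_ind: x => [|a q x IH]; first by rewrite /xact_comm !linear0 addr0.
by apply: xact_comm_linear => //; apply/xact_comm_deg/degle_zmon/leqnn.
Qed.

(** * The map psi from P to an algebra in which the relations hold *)

Section Relations.
Variables (B : algType K) (x : 'I_n -> B) (y : gT -> B).

Record pbw_relations : Prop := {
  rel1 : y 1%g = 1;
  relM : forall g h, y g * y h = y (g * h)%g;
  rel_chi : forall g i, y g * x i = chi g i *: (x i * y g);
  rel_br : forall i j,
    x i * x j = e i j *: (x j * x i) + \sum_p c i j p *: (x p.1 * y p.2)
}.
Hypothesis rel : pbw_relations.

Definition pbw_psi : P -> B :=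
  fm_lift P (fun q => (\prod_(i <- enum 'I_n) x i ^+ q.1 i) * y q.2).
HB.instance Definition _ := GRing.Linear.on pbw_psi.

Lemma pbw_psiE m g : pbw_psi (zmon (m, g)) = (\prod_(i <- enum 'I_n) x i ^+ m i) * y g.
Proof. exact: fm_lift_base. Qed.

Lemma rel_chi_exp g i b : y g * x i ^+ b = chi g i ^+ b *: (x i ^+ b * y g).
Proof.
elim: b => [|b IH]; first by rewrite !expr0 mulr1 mul1r scale1r.
rewrite !exprS mulrA (rel_chi rel) -scalerAl.
by rewrite -(mulrA _ (y g)) IH -scalerAr scalerA !mulrA.
Qed.

Lemma rel_chi_prod g m (s : seq 'I_n) : y g * (\prod_(i <- s) x i ^+ m i)
  = (\prod_(i <- s) chi g i ^+ m i) *: ((\prod_(i <- s) x i ^+ m i) * y g).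
Proof.
elim: s => [|i s IHs]; first by rewrite !big_nil mulr1 scale1r mul1r.
rewrite !big_cons mulrA rel_chi_exp -scalerAl -(mulrA _ (y g)) IHs.
by rewrite -scalerAr scalerA -!mulrA.
Qed.

Lemma psi_grpact g z : y g * pbw_psi z = pbw_psi (grpact g z).
Proof.
elim/fm_ind: z => [|a [m h] z IH]; first by rewrite !linear0 mulr0.
rewrite !linearP /= mulrDr -scalerAr IH; congr (_ *: _ + _).
rewrite grpactE linearZ /= !pbw_psiE -(relM rel) [LHS]mulrA rel_chi_prod big_enum.
by rewrite -scalerAl mulrA.
Qed.

(** In the ordered product, the factors to the left of x_i have exponent 0, so x_i is absorbed into
    its own power. *)
Lemma psi_xact_above i m g : mabove i m ->
  x i * pbw_psi (zmon (m, g)) = pbw_psi (xact i (zmon (m, g))).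
Proof.
have tr : transitive (fun j k : 'I_n => (j < k)%N) by move=> j k l; exact: ltn_trans.
move=> im; rewrite xact_above // !pbw_psiE mulrA; congr (_ * _).
have := enum_sorted n; have : i \in enum 'I_n by rewrite mem_enum.
elim: (enum 'I_n) => //= j s IH.
rewrite inE (path_sortedE tr) !big_cons => ijs /andP[/allP js ss].
have [ij|ij] := eqVneq i j.
  rewrite -ij in js *; rewrite ffunE eqxx addn1 exprS -mulrA; congr (_ * (_ * _)).
  apply: eq_big_seq => k /js ik; rewrite ffunE; case: eqP => [ki|_]; last by rewrite addn0.
  by rewrite ki ltnn in ik.
move: ijs; rewrite (negbTE ij) /= => is_.
have mj : m j = 0%N by move/maboveP: im; apply; apply: js.
by rewrite ffunE eq_sym (negbTE ij) mj !mul1r; apply: IH.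
Qed.

(** Induction on the degree: the relation [rel_br] in B has the same shape as the rule [xact_incr]
    on P. *)
Lemma psi_xact_deg d i z : degle d z -> x i * pbw_psi z = pbw_psi (xact i z).
Proof.
elim: d i z => [|d IH] i z; elim=> [|a w t [[m g] md ->] _ IHt].
- by rewrite !linear0 mulr0.
- rewrite !linearP /= mulrDr -scalerAr IHt; congr (_ *: _ + _).
  case: (monP i m) md => [im|j m' -> ji jm'] /=; first by rewrite psi_xact_above.
  by rewrite mdeg_incr.
- by rewrite !linear0 mulr0.
rewrite !linearP /= mulrDr -scalerAr IHt; congr (_ *: _ + _) => {IHt}.
case: (monP i m) md => [im|j m' -> ji jm'] /=; first by rewrite psi_xact_above.
rewrite mdeg_incr ltnS => md.
have dz : degle d (zmon (m', g)) by apply: degle_zmon.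
rewrite -xact_above // -psi_xact_above // mulrA (rel_br rel).
rewrite mulrDl -scalerAl -mulrA (IH i _ dz) xact_above // xact_incr //.
rewrite linearD linearZ /=; congr (_ *: _ + _).
  (* As before, x_i z_m' may have degree d + 1: its leading term is ordered under x_j, and t' is
     within reach of [IH]. *)
  have [t' dt ->] := xact_lead i m' g.
  rewrite !linearP /= mulrDr -scalerAr psi_xact_above ?mabove_incr 1?ltnW //.
  by rewrite IH //; apply: degleW dt.
rewrite /lact !linear_sum mulr_suml; apply: eq_bigr => p _.
rewrite !linearZ /= -scalerAl -mulrA psi_grpact IH //.
exact: degle_grpact.
Qed.

Lemma psi_xact i z : x i * pbw_psi z = pbw_psi (xact i z).
Proof.
elim/fm_ind: z => [|a q z IH]; first by rewrite !linear0 mulr0.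
rewrite !linearP /= mulrDr -scalerAr IH; congr (_ *: _ + _).
exact/psi_xact_deg/degle_zmon/leqnn.
Qed.

End Relations.

End PbwModule.

(** * Modules over the enveloping algebra *)

Lemma mulrPl (K : fieldType) (B : algType K) a (x y z : B) :
  (a *: x + y) * z = a *: (x * z) + y * z.
Proof. by rewrite mulrDl scalerAl. Qed.

Record algebra_action (K : fieldType) (B : algType K) (N : lmodType K)
    (act : B -> N -> N) : Prop := {
  aact_linear : forall b, linear (act b);
  aactPl : forall a b b' x, act (a *: b + b') x = a *: act b x + act b' x;
  aact1 : forall x, act 1 x = x;
  aactM : forall b b' x, act (b * b') x = act b (act b' x)
}.

Section AlgebraAction.
Variables (K : fieldType) (B : algType K) (N : lmodType K) (act : B -> N -> N).
Hypothesis actP : algebra_action act.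

Lemma aactr0 b : act b 0 = 0.
Proof. by have := aact_linear actP b (-1) 0 0; rewrite !scaleN1r !addNr. Qed.
Lemma aact0 x : act 0 x = 0.
Proof. by have := aactPl actP (-1) 0 0 x; rewrite !scaleN1r !addNr. Qed.
Lemma aactZl a b x : act (a *: b) x = a *: act b x.
Proof. by rewrite -[a *: b]addr0 (aactPl actP) aact0 addr0. Qed.
Lemma aactDl b b' x : act (b + b') x = act b x + act b' x.
Proof. by rewrite -[b]scale1r (aactPl actP) !scale1r. Qed.
Lemma aactBl b b' x : act (b - b') x = act b x - act b' x.
Proof. by rewrite aactDl -[- b']scaleN1r aactZl scaleN1r. Qed.

Variable I : ideal B.
Hypothesis Iact : forall b x, I b -> act b x = 0.

Definition quot_act (q : quotalg I) (x : N) : N := act (qrepr q) x.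

Lemma quot_actE b x : quot_act (to_quot I b) x = act b x.
Proof. by apply/eqP; rewrite -subr_eq0 -aactBl; apply/eqP/Iact/qrepr_ideal. Qed.

Lemma quot_actP : algebra_action quot_act.
Proof.
split=> [q|a p q x|x|p q x]; first exact: aact_linear actP _.
- have [b ->] := to_quot_surj p; have [b' ->] := to_quot_surj q.
  by rewrite -linearP !quot_actE (aactPl actP).
- by rewrite -(rmorph1 (to_quot I)) quot_actE (aact1 actP).
- have [b ->] := to_quot_surj p; have [b' ->] := to_quot_surj q.
  by rewrite -rmorphM !quot_actE (aactM actP).
Qed.

End AlgebraAction.

Lemma monoid_alg_actP (K : fieldType) (M : monoidType) (N : lmodType K) (f : M -> N -> N) :
  (forall m, linear (f m)) -> (forall x, f 1%g x = x) ->
  (forall m m' x, f (m * m')%g x = f m (f m' x)) ->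
  algebra_action (fun (b : monoid_alg K M) x => mlift (f^~ x) b).
Proof.
move=> flin f1 fM; set F := fun b x => _.
have lin b : linear (F b).
  move=> a x y; rewrite /F -mliftDf; congr mlift.
  by apply/boolp.funext => m; rewrite flin.
have linl a b b' x : F (a *: b + b') x = a *: F b x + F b' x by exact: linearP.
have F0 x : F 0 x = 0 by exact: linear0.
have FU m x : F (mbase m) x = f m x by exact: mliftE.
split=> // [x|b b' x]; first by rewrite -mbase1 FU f1.
elim/monoid_alg_ind: b => [|a m b IH]; first by rewrite mul0r !F0.
rewrite mulrDl -scalerAl !linl IH; congr (_ *: _ + _) => {IH}.
elim/monoid_alg_ind: b' => [|a' m' b' IH].
  by rewrite mulr0 !F0; have := lin (mbase m) (-1) 0 0; rewrite !scaleN1r !addNr.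
by rewrite mulrDr -scalerAr !linl lin IH mbaseM !FU fM.
Qed.

(** * Generators and relations of U(L) *)

Section UenvGenerators.
Variables (K : fieldType) (A : zmodType) (eps : A -> A -> K) (R : algType K).
Variables (L : bimodule R) (DL : A -> L -> Prop) (br : L -> L -> L).
Local Notation U := (uenv eps DL br).

Definition uenv_of_ring (r : R) : U := to_uenv eps DL br (tens0 L r).
Definition uenv_of_lie (l : L) : U := to_uenv eps DL br (tens1 l).

Lemma tens_lin a r r' (s : seq L) : tens s (a *: r + r') = a *: tens s r + tens s r'.
Proof.
rewrite /tens -linearP; apply/to_quot_eq; rewrite opprD addrA.
exact: lspan_in (tensor_linear_last s a r r').
Qed.

Lemma tens1_lin a l l' : tens1 (a *: l + l') = a *: tens1 l + tens1 l' :> tensor_alg L.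
Proof.
rewrite /tens1 /tens -linearP; apply/to_quot_eq; rewrite opprD addrA.
exact: lspan_in (tensor_linear_slot [::] a l l' [::] 1).
Qed.

Lemma uenv_of_ring_linear : linear uenv_of_ring.
Proof. by move=> a r r'; rewrite /uenv_of_ring /tens0 tens_lin linearP. Qed.
HB.instance Definition _ :=
  GRing.isLinear.Build K R U *:%R uenv_of_ring uenv_of_ring_linear.

Lemma uenv_of_lie_linear : linear uenv_of_lie.
Proof. by move=> a l l'; rewrite /uenv_of_lie tens1_lin linearP. Qed.
HB.instance Definition _ :=
  GRing.isLinear.Build K L U *:%R uenv_of_lie uenv_of_lie_linear.

Lemma uenv_of_ringM r s : uenv_of_ring (r * s) = uenv_of_ring r * uenv_of_ring s.
Proof. by rewrite /uenv_of_ring -rmorphM tens0M. Qed.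

Lemma uenv_of_ring1 : uenv_of_ring 1 = 1.
Proof. exact: rmorph1. Qed.

Lemma uenv_of_lscal r l : uenv_of_lie (lscal r l) = uenv_of_ring r * uenv_of_lie l.
Proof. by rewrite /uenv_of_lie /uenv_of_ring -tens1_l rmorphM. Qed.

Lemma uenv_of_rscal r l : uenv_of_lie (rscal l r) = uenv_of_lie l * uenv_of_ring r.
Proof. by rewrite /uenv_of_lie /uenv_of_ring -tens1_r rmorphM. Qed.

Lemma uenv_of_lieM a b l l' : DL a l -> DL b l' ->
  uenv_of_lie l * uenv_of_lie l'
  = eps a b *: (uenv_of_lie l' * uenv_of_lie l) + uenv_of_lie (br l l').
Proof.
move=> Dl Dl'; apply/eqP; rewrite -subr_eq0 opprD addrA; apply/eqP.
have : to_uenv eps DL br (tens1 l * tens1 l' - eps a b *: (tens1 l' * tens1 l)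
    - tens1 (br l l')) = 0.
  rewrite -(raddf0 (to_uenv eps DL br)); apply/to_quot_eq; rewrite subr0.
  by apply: ideal_gen_in; apply: Uenv_rel.
by rewrite !raddfB /= linearZ /= !rmorphM.
Qed.

(** The products l_1 ... l_m r span U(L), because a word is its first letter times the remaining
    word. *)
Lemma uenv_ind (S : U -> Prop) :
  (forall r, S (uenv_of_ring r)) ->
  (forall l u, S u -> S (uenv_of_lie l * u)) ->
  (forall a u u', S u -> S u' -> S (a *: u + u')) -> forall u, S u.
Proof.
move=> Sr Sl SD u; have [t ->] := to_quot_surj u.
have [w ->] := to_quot_surj t; elim/monoid_alg_ind: w => [|a [s r] w IH].
  by have := Sr 0; rewrite linear0 !raddf0.
rewrite !linearP; apply: SD => // {IH}.
elim: s => [|l s IH]; first exact: Sr.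
suff -> : mbase ((l :: s, r) : tword L) = mbase (([:: l], 1) : tword L) * mbase ((s, r) : tword L)
    :> monoid_alg K (tword L).
  by rewrite !rmorphM; apply: Sl.
(* Concatenation moves the coefficient 1 of the first word into the coefficient r or into the next
   letter. *)
rewrite mbaseM; congr mbase; case: s {IH} => [|y s].
  by congr pair; rewrite mul1r.
by congr (_ :: _ :: _, _); rewrite /= lscal1.
Qed.

End UenvGenerators.

(** * Extension of compatible actions of L and R to an action of U(L) *)

Section UenvAction.
Variables (K : fieldType) (A : zmodType) (eps : A -> A -> K) (R : algType K).
Variables (L : bimodule R) (DL : A -> L -> Prop) (br : L -> L -> L).
Variables (N : lmodType K) (X : L -> N -> N) (T : R -> N -> N).

(** Linearity, [um_lscal] and [um_rscal] make the operators factor through the tensor algebra;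
    [um_rel] makes the ideal J act by zero. *)
Record uenv_module : Prop := {
  um_T : algebra_action T;
  um_linear : forall l, linear (X l);
  um_linearl : forall a l l' x, X (a *: l + l') x = a *: X l x + X l' x;
  um_lscal : forall r l x, X (lscal r l) x = T r (X l x);
  um_rscal : forall r l x, X (rscal l r) x = X l (T r x);
  um_rel : forall a b u w x, DL a u -> DL b w ->
    X u (X w x) - eps a b *: X w (X u x) = X (br u w) x
}.

Hypothesis um : uenv_module.

Definition word_act (w : tword L) (x : N) : N := foldr X (T w.2 x) w.1.

Lemma word_actM u w x : word_act (u * w)%g x = word_act u (word_act w x).
Proof.
case: u w => [s r] [[|y s'] r'] /=; first by rewrite /word_act /= (aactM (um_T um)).
by rewrite /word_act /= foldr_cat /= (um_lscal um).
Qed.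

Lemma foldr_linear s : linear (fun x => foldr X x s).
Proof. by move=> a x y; elim: s => //= l s ->; rewrite (um_linear um). Qed.

Lemma word_act_linear w : linear (word_act w).
Proof. by move=> a x y; rewrite /word_act (aact_linear (um_T um)) foldr_linear. Qed.

Definition words_act (w : monoid_alg K (tword L)) (x : N) : N :=
  mlift (word_act^~ x) w.

Lemma words_actE w x : words_act (mbase w) x = word_act w x.
Proof. exact: mliftE. Qed.

Lemma words_actP : algebra_action words_act.
Proof.
apply: monoid_alg_actP => [w|x|u w x]; [exact: word_act_linear| |exact: word_actM].
by rewrite /word_act (aact1 (um_T um)).
Qed.

Lemma tensor_rel_act w x : tensor_rel w -> words_act w x = 0.
Proof.
case=> {w} => [s a l l' s' r|s a r r'|s l t l' s' r|s l t r].
all: rewrite !(aactBl words_actP) ?(aactZl words_actP) !words_actE /word_act /=.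
- by rewrite !foldr_cat /= (um_linearl um) foldr_linear addrAC addrK subrr.
- by rewrite (aactPl (um_T um)) foldr_linear addrAC addrK subrr.
- by rewrite !foldr_cat /= (um_rscal um) (um_lscal um) subrr.
- by rewrite !foldr_cat /= (um_rscal um) (aactM (um_T um)) subrr.
Qed.

Lemma tensor_ideal_act w x : tensor_ideal L w -> words_act w x = 0.
Proof.
elim=> [|a u v Su _ IH]; first exact: aact0 words_actP x.
by rewrite (aactPl words_actP) IH tensor_rel_act // scaler0 addr0.
Qed.

Definition tensor_act : tensor_alg L -> N -> N := @quot_act _ _ _ words_act (tensor_ideal L).

Lemma tensor_actP : algebra_action tensor_act.
Proof. by apply: quot_actP => [|w x]; [exact: words_actP|exact: tensor_ideal_act]. Qed.

Lemma tensor_act1 l x : tensor_act (tens1 l) x = X l x.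
Proof.
rewrite /tensor_act /tens1 /tens quot_actE.
- by rewrite words_actE /word_act /= (aact1 (um_T um)).
- exact: words_actP.
- by move=> w y; exact: tensor_ideal_act.
Qed.

Lemma tensor_act0 r x : tensor_act (tens0 L r) x = T r x.
Proof.
rewrite /tensor_act /tens0 /tens quot_actE; first by rewrite words_actE.
  exact: words_actP.
by move=> w y; exact: tensor_ideal_act.
Qed.

Lemma uenv_ideal_act t x : uenv_ideal eps DL br t -> tensor_act t x = 0.
Proof.
have aP := tensor_actP.
move=> It; elim: It x => {t} [t [a b u v Du Dv]||t t' _ IH _ IH'|a t _ IH|a t _ IH] x.
- rewrite !(aactBl aP) (aactZl aP) !(aactM aP) !tensor_act1 (um_rel um) //.
  by rewrite subrr.
- exact: aact0.
- by rewrite (aactDl aP) IH IH' addr0.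
- by rewrite (aactM aP) IH (aactr0 aP).
- by rewrite (aactM aP) IH.
Qed.

Definition uenv_act : uenv eps DL br -> N -> N := @quot_act _ _ _ tensor_act (uenv_ideal eps DL br).

Lemma uenv_actP : algebra_action uenv_act.
Proof. by apply: quot_actP => [|w x]; [exact: tensor_actP|exact: uenv_ideal_act]. Qed.

Lemma uenv_actE t x : uenv_act (to_uenv eps DL br t) x = tensor_act t x.
Proof. by apply: quot_actE => [|u y]; [exact: tensor_actP|exact: uenv_ideal_act]. Qed.

Lemma uenv_act_lie l x : uenv_act (uenv_of_lie eps DL br l) x = X l x.
Proof. by rewrite uenv_actE tensor_act1. Qed.

Lemma uenv_act_ring r x : uenv_act (uenv_of_ring eps DL br r) x = T r x.
Proof. by rewrite uenv_actE tensor_act0. Qed.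

End UenvAction.

(** * The Yetter-Drinfeld case *)

Section YetterDrinfeldPbw.
Variables (K : fieldType) (K_char0 : [pchar K] =i pred0).
Variables (gT : finGroupType) (G_abelian : abelian [set: gT]).
Variables (V : vectType K) (rho : linear_action gT V).
Variables (A : zmodType) (eps : A -> A -> K).
Hypotheses (eps_bichar : bicharacter eps) (eps_antisym : antisymmetric_bichar eps).
Variables (DG : A -> monoid_alg K gT -> Prop) (DG_graded : graded_algebra DG).
Local Notation L := (smash_bimod rho).
Variables (DL : A -> L -> Prop) (br : L -> L -> L).
Hypothesis L_color : color_lie_ring eps DG DL br.
Variables (DV : A -> V -> Prop) (L_YD : yetter_drinfeld eps DG DL DV).
Hypothesis L_pos : purely_positive eps DV.
Hypothesis eps_group : trivial_on_group V eps DG.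
Variables (n : nat) (v : n.-tuple V) (v_basis : basis_of fullv v).
Variables (vdeg : 'I_n -> A) (v_deg : forall i, DV (vdeg i) (tnth v i)).
Variables (gdeg : gT -> A) (g_deg : forall g, DG (gdeg g) (mbase g)).
Implicit Types (i j k : 'I_n) (g h : gT) (l : L) (p q : 'I_n * gT).

(** * Coordinates and degrees on L *)

Definition ldeg p : A := vdeg p.1 + gdeg p.2.
Definition lbase p : L := vtens (tnth v p.1) p.2.
Definition lgen i : L := lbase (i, 1%g).
Definition lcoord l : {ffun 'I_n * gT -> K^o} := [ffun p => coord v p.1 (l p.2)].

Definition veps i j := eps (vdeg i) (vdeg j).
Definition gveps g i := eps (gdeg g) (vdeg i).
Definition brc i j := lcoord (br (lgen i) (lgen j)).

Lemma mbase_neq0 g : mbase g != 0 :> monoid_alg K gT.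
Proof.
apply/eqP => g0; have := mbase1_neq0 K gT.
by rewrite -(mulgV g) -mbaseM g0 mul0r eqxx.
Qed.

Lemma lcoord_linear : linear lcoord.
Proof. by move=> a l l'; apply/ffunP => p; rewrite !ffunE linearP. Qed.
HB.instance Definition _ :=
  GRing.isLinear.Build K L {ffun 'I_n * gT -> K^o} *:%R lcoord lcoord_linear.

Lemma lcoordE l : l = \sum_p lcoord l p *: lbase p.
Proof.
apply/ffunP => h; rewrite sum_ffunE.
have E p : (lcoord l p *: lbase p : {ffun gT -> V}) h
    = if p.2 == h then coord v p.1 (l h) *: tnth v p.1 else 0.
  by rewrite !ffunE eq_sym; case: eqP => [->|]; rewrite ?scaler0.
under eq_bigr do rewrite E.
rewrite -(pair_bigA _ (fun i g => if g == h then coord v i (l h) *: tnth v i else 0)) /=.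
rewrite {1}(coord_basis v_basis (memvf (l h))); apply: eq_bigr => i _.
by rewrite -big_mkcond big_pred1_eq (tnth_nth 0).
Qed.

Lemma lcoord_base p q : lcoord (lbase p) q = (p == q)%:R.
Proof.
case: p q => [i g] [j h]; rewrite !ffunE /= xpair_eqE [h == g]eq_sym.
case: eqP => _; last by rewrite andbF linear0.
by rewrite andbT (tnth_nth 0) coord_free ?(basis_free v_basis) // eq_sym.
Qed.

Lemma v_neq0 i : tnth v i != 0.
Proof. by apply: (free_not0 (basis_free v_basis)); exact: mem_tnth. Qed.

Lemma V_neq0 i : (fullv : {vspace V}) != 0%VS.
Proof.
apply/eqP => V0; have := memvf (tnth v i); rewrite V0 memv0.
by apply/negP; exact: v_neq0.
Qed.

(** The index i serves as a witness that V is nonzero, as [trivial_on_group] demands. *)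
Lemma eps_gdeg i g h : eps (gdeg g) (gdeg h) = 1.
Proof. by apply: (eps_group (V_neq0 i)) => //; apply: g_deg. Qed.

Lemma gdegM g h : gdeg (g * h)%g = gdeg g + gdeg h.
Proof.
apply: (grading_uniq (galg_grading DG_graded) (g_deg _) _ (mbase_neq0 _)).
by rewrite -mbaseM; apply: (galg_mul DG_graded).
Qed.

Lemma lbase_deg p : DL (ldeg p) (lbase p).
Proof. exact: (yd_induced L_YD). Qed.

Lemma lbase_rscal p h : rscal (lbase p) (mbase h) = lbase (p.1, (p.2 * h)%g).
Proof. by rewrite -[lbase p]lscal1 -mbase1 smash_bimodE lin_act1 id_lfunE mul1g. Qed.

Lemma lbase_lscal p g : lscal (mbase g) (lbase p) = gveps g p.1 *: lbase (p.1, (g * p.2)%g).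
Proof.
rewrite -[LHS]rscal1 -mbase1 smash_bimodE mulg1 (yd_action L_YD (v_deg _) (g_deg g)).
by apply/ffunP => h; rewrite !ffunE; case: eqP; rewrite ?scaler0.
Qed.

Lemma lcoord_rscal l h : lcoord (rscal l (mbase h)) = lrmul (lcoord l) h.
Proof. by apply/ffunP => p; rewrite /rscal /= smash_ractU !ffunE. Qed.

Lemma lcoord_sum (Q : pred ('I_n * gT)) (a : 'I_n * gT -> K) q :
  lcoord (\sum_(p | Q p) a p *: lbase p) q = if Q q then a q else 0.
Proof.
rewrite linear_sum sum_ffunE; case: ifP => Qq.
  rewrite (bigD1 q) //= big1 ?addr0 => [|p /andP[_ /negbTE pq]].
    by rewrite linearZ ffunE lcoord_base eqxx; exact: mulr1.
  by rewrite linearZ ffunE lcoord_base pq scaler0.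
apply: big1 => p Qp; rewrite linearZ ffunE lcoord_base.
by case: eqP => [pq|_]; [rewrite -pq Qp in Qq|rewrite scaler0].
Qed.

(** The basis expansion of l, grouped by degree, must agree with l placed in degree a, since the sum
    of the graded components is direct. *)
Lemma ldeg_homogeneous a l p : DL a l -> lcoord l p != 0 -> ldeg p = a.
Proof.
move=> Dl; apply: contra_neq_eq => pa.
have gL := gbimod_grading (clr_graded L_color).
pose s := undup (a :: map ldeg (enum {: 'I_n * gT})).
(* The f d are homogeneous and sum to l - l = 0 over s, so each of them vanishes. In a degree other
   than a this kills the coordinates of l. *)
pose f d := \sum_(q | ldeg q == d) lcoord l q *: lbase q - (if d == a then l else 0).
have Df d : DL d (f d).
  rewrite /f addrC -[if _ then _ else _]addr0 opprD oppr0 addr0 -scaleN1r.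
  apply: (gradingP gL); first by case: eqP => [->|_] //; exact: (grading0 gL).
  apply: big_ind => [|x y Dx Dy|q /eqP <-]; first exact: (grading0 gL).
    by rewrite -[x]scale1r; apply: (gradingP gL).
  by rewrite -[_ *: _]addr0; apply: (gradingP gL); [exact: lbase_deg|exact: (grading0 gL)].
have s1 b : b \in s -> forall x : L, \sum_(d <- s) (if d == b then x else 0) = x.
  move=> bs x; rewrite (bigD1_seq b) ?undup_uniq //= eqxx big1 ?addr0 // => d /negbTE -> //.
have sum_f : \sum_(d <- s) f d = 0.
  rewrite sumrB s1; last by rewrite mem_undup mem_head.
  rewrite [X in _ - X]lcoordE; apply/eqP; rewrite subr_eq0; apply/eqP.
  under eq_bigr do rewrite big_mkcond; rewrite exchange_big /=; apply: eq_bigr => q _.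
  under eq_bigr do rewrite eq_sym; apply: s1.
  by rewrite mem_undup inE map_f ?orbT // mem_enum.
have := grading_direct gL (undup_uniq _) Df sum_f _.
move/(_ (ldeg p)); rewrite mem_undup inE map_f ?orbT ?mem_enum // => /(_ isT).
rewrite /f (negbTE pa) subr0 => /(congr1 lcoord)/ffunP/(_ p).
rewrite lcoord_sum eqxx linear0 => ->.
by rewrite ffunE.
Qed.

(** Reduces identities between homogeneous elements to basis elements of the same degree, so that
    the factor eps does not change. *)
Lemma ldeg_span a l : DL a l -> lspan (fun x => exists2 p, ldeg p = a & x = lbase p) l.
Proof.
move=> Dl; rewrite [l]lcoordE; apply: big_ind => [|x y|p _].
- exact: lspan0.
- exact: lspanD.
have [->|lp] := eqVneq (lcoord l p) 0; first by rewrite scale0r; apply: lspan0.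
by apply/lspanZ/lspan_in; exists p => //; apply: ldeg_homogeneous Dl lp.
Qed.

(** * The bracket of L in coordinates *)

Lemma rscal0 (l : L) : rscal l 0 = 0.
Proof. by have := rscalPr l (-1) 0 0; rewrite !scaleN1r !addNr. Qed.
Lemma br0r x : br x 0 = 0.
Proof. by have := clr_linr L_color (-1) x 0 0; rewrite !scaleN1r !addNr. Qed.
Lemma br0l x : br 0 x = 0.
Proof. by have := clr_linl L_color (-1) 0 0 x; rewrite !scaleN1r !addNr. Qed.
Lemma brZr a x y : br x (a *: y) = a *: br x y.
Proof. by have := clr_linr L_color a x y 0; rewrite !addr0 br0r addr0. Qed.
Lemma brNr x y : br x (- y) = - br x y.
Proof. by rewrite -scaleN1r brZr scaleN1r. Qed.

Lemma lgen_rscal i g : rscal (lgen i) (mbase g) = lbase (i, g).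
Proof. by rewrite lbase_rscal mul1g. Qed.

Lemma lgen_deg i : DL (vdeg i) (lgen i).
Proof.
have := lbase_deg (i, 1%g); rewrite /ldeg /=; suff -> : gdeg 1%g = 0 by rewrite addr0.
by apply: (addrI (gdeg 1%g)); rewrite -gdegM mulg1 addr0.
Qed.

Lemma br_rscal x y r : br x (rscal y r) = rscal (br x y) r.
Proof. by have := clr_bilinear L_color 1 r x y; rewrite !lscal1. Qed.

(** Balancedness moves g into the second argument; it passes v_j at the cost of eps(|g|, |v_j|) and
    leaves on the right together with h. *)
Lemma br_base i g j h : br (lbase (i, g)) (lbase (j, h))
  = gveps g j *: rscal (br (lgen i) (lgen j)) (mbase (g * h)%g).
Proof.
rewrite -lgen_rscal (clr_balanced L_color) lbase_lscal brZr /=.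
by rewrite -lgen_rscal br_rscal.
Qed.

Lemma lcoord_br i l : lcoord (br (lgen i) l) = ladj brc i (lcoord l).
Proof.
have H : br (lgen i) l = \sum_p lcoord l p *: br (lgen i) (lbase p).
  rewrite [in LHS](lcoordE l).
  elim: (index_enum _) => [|p s IH]; first by rewrite !big_nil br0r.
  by rewrite !big_cons (clr_linr L_color) IH.
rewrite H linear_sum; apply: eq_bigr => -[j h] _.
by rewrite linearZ /= -lgen_rscal br_rscal lcoord_rscal.
Qed.

Lemma brc_deg i j p : brc i j p != 0 -> ldeg p = vdeg i + vdeg j.
Proof. by apply: ldeg_homogeneous; apply: (clr_degree L_color); exact: lgen_deg. Qed.

(** A term v_k (x) g of [v_i, v_j] has |v_k||g| = |v_i||v_j|. Pairing this with group degrees, on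
    which eps is trivial, gives [cc_chi]; pairing it with the degrees of the v_k gives [cc_e]. *)
Lemma color_constantsP : color_constants veps gveps brc.
Proof.
split.
- by move=> g h; apply: (centsP G_abelian); rewrite inE.
- by move=> i; apply: (L_pos (v_deg i)); exact: v_neq0.
- by move=> i j; rewrite /veps eps_antisym mulVf ?(bichar_neq0 eps_bichar).
- by move=> g i; exact: (bichar_neq0 eps_bichar).
- by move=> g h i; rewrite /gveps gdegM (bicharDl eps_bichar).
- move=> i; suff bri0 : br (lgen i) (lgen i) = 0 by rewrite /brc bri0 linear0.
  (* Since eps(|v_i|, |v_i|) = 1, antisymmetry says 2 [v_i, v_i] = 0, and 2 is invertible. *)
  have := clr_antisym L_color (lgen_deg i) (lgen_deg i).
  rewrite (L_pos (v_deg i)) ?v_neq0 // scale1r => /eqP; rewrite -addr_eq0 -mulr2n.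
  by rewrite -scaler_nat scaler_eq0 => /orP[|/eqP //]; have /pcharf0P -> := K_char0.
- move=> i j; rewrite /brc (clr_antisym L_color (lgen_deg j) (lgen_deg i)).
  by rewrite -scaleNr linearZ.
- move=> g i j p /brc_deg dp; rewrite /gveps -(bicharDr eps_bichar) -dp.
  by rewrite (bicharDr eps_bichar) (eps_gdeg i) mulr1.
- move=> k i j p /brc_deg dp; rewrite /veps -(bicharDr eps_bichar) -dp /ldeg.
  rewrite (bicharDr eps_bichar) /gveps (eps_antisym (vdeg k)) mulfK //.
  exact: (bichar_neq0 eps_bichar).
- move=> i j k; rewrite /brc -!lcoord_br -!linearZ -linearD; congr lcoord.
  have := clr_jacobi L_color (lgen_deg i) (lgen_deg j) (lgen_deg k).
  rewrite -/(veps k i) -/(veps i j) -/(veps j k).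
  rewrite (clr_antisym L_color (lgen_deg k) (lgen_deg i)) -/(veps k i).
  have eV : veps i k * veps k i = 1.
    by rewrite /veps (eps_antisym (vdeg k)) mulVf ?(bichar_neq0 eps_bichar).
  (* Multiplication by [veps i k] normalizes the coefficient of [v_i, [v_j, v_k]] to 1. *)
  move=> /(congr1 (fun l => veps i k *: l)); rewrite scaler0 brNr brZr scalerN.
  rewrite !scalerDr scalerN !scalerA mulrAC eV mul1r scale1r [veps i k * veps j k]mulrC.
  by rewrite addrAC => /eqP; rewrite subr_eq0 => /eqP.
Qed.

(** * The action of U(L) on P and the independence of the monomials *)

Local Notation P := (free_module_of K ({ffun 'I_n -> nat} * gT)%type).
Local Notation pX := (@xact K gT n P veps gveps brc).
Local Notation pT := (@grpact K gT n P gveps).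
Local Notation pL := (@lact K gT n P veps gveps brc).
Local Notation zmon := (fm_base P).
Local Notation U := (uenv eps DL br).
Local Notation uR := (uenv_of_ring eps DL br).
Local Notation uL := (uenv_of_lie eps DL br).

Definition pbw_lact (l : L) (x : P) : P := pL (lcoord l) x.
Definition pbw_ract (r : monoid_alg K gT) (x : P) : P := mlift (pT^~ x) r.

Lemma mchi0 g : mchi gveps g [ffun => 0%N] = 1.
Proof. by rewrite /mchi big1 // => i _; rewrite ffunE expr0. Qed.

Lemma chi1 i : gveps 1%g i = 1.
Proof.
have := cc_chiM color_constantsP 1%g 1%g i; rewrite mulg1 => h.
by apply: (mulfI (cc_chi_neq0 color_constantsP 1%g i)); rewrite -h mulr1.
Qed.

Lemma pbw_ractU g x : pbw_ract (mbase g) x = pT g x.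
Proof. exact: mliftE. Qed.

Lemma pbw_ractP : algebra_action pbw_ract.
Proof.
apply: monoid_alg_actP => [g|x|g h x]; [exact: linearP| |].
  elim/fm_ind: x => [|a [m g] x IH]; first by rewrite linear0.
  rewrite linearP /= IH grpactE mul1g; congr (_ *: _ + _).
  by rewrite /mchi big1 ?scale1r // => i _; rewrite chi1 expr1n.
by rewrite (grpactM color_constantsP).
Qed.

Lemma pbw_lact_base p x : pbw_lact (lbase p) x = pX p.1 (pT p.2 x).
Proof.
rewrite /pbw_lact /lact (bigD1 p) //= big1 ?addr0 => [|q /negbTE qp].
  by rewrite lcoord_base eqxx scale1r.
by rewrite lcoord_base eq_sym qp scale0r.
Qed.

Lemma pbw_lact_linearl a l l' x :
  pbw_lact (a *: l + l') x = a *: pbw_lact l x + pbw_lact l' x.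
Proof. by rewrite /pbw_lact linearP lactPl. Qed.

Lemma pbw_lact_linear l : linear (pbw_lact l).
Proof. exact: linearP. Qed.

Lemma pbw_lact0 x : pbw_lact 0 x = 0.
Proof. by rewrite /pbw_lact linear0 lact0. Qed.

Lemma lbase_ind (S : L -> Prop) :
  S 0 -> (forall a p l, S l -> S (a *: lbase p + l)) -> forall l, S l.
Proof.
move=> S0 SD l; rewrite [l]lcoordE; elim: (index_enum _) => [|p s IH].
  by rewrite big_nil.
by rewrite big_cons; apply: SD.
Qed.

Lemma pbw_uenv_module : uenv_module eps DL br pbw_lact pbw_ract.
Proof.
have cc := color_constantsP; have rP := pbw_ractP.
split=> //; [exact: pbw_lact_linear|exact: pbw_lact_linearl|..].
- move=> r l x; elim/monoid_alg_ind: r => [|a g r IH].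
    have -> : lscal 0 l = 0 by have := lscalPl l (-1) 0 0; rewrite !scaleN1r !addNr.
    by rewrite pbw_lact0 (aact0 rP).
  rewrite lscalPl pbw_lact_linearl IH (aactPl rP); congr (_ *: _ + _) => {IH}.
  elim/lbase_ind: l => [|a' p l IH].
    have -> : lscal (mbase g) (0 : L) = 0.
      by have := lscalP (mbase g) (-1) (0 : L) 0; rewrite !scaleN1r !addNr.
    by rewrite pbw_lact0 (aactr0 rP).
  rewrite lscalP !pbw_lact_linearl IH (aact_linear rP); congr (_ *: _ + _) => {IH}.
  rewrite lbase_lscal pbw_ractU pbw_lact_base (grpact_xact cc) (grpactM cc).
  by rewrite /pbw_lact linearZ lactZ -/(pbw_lact _ _) pbw_lact_base.
- move=> r l x; elim/monoid_alg_ind: r => [|a g r IH].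
    by rewrite rscal0 pbw_lact0 (aact0 rP) /pbw_lact linear0.
  rewrite rscalPr pbw_lact_linearl IH (aactPl rP) pbw_lact_linear; congr (_ *: _ + _).
  by rewrite /pbw_lact lcoord_rscal (lact_lrmul cc) pbw_ractU.
move=> a b u w x Du Dw.
suff -> : pbw_lact u (pbw_lact w x)
    = pbw_lact (br u w) x + eps a b *: pbw_lact w (pbw_lact u x) by rewrite addrK.
(* First u, then w, is reduced to a basis element of its degree. *)
elim: (ldeg_span Du) => [|a1 l1 u' [p pa ->] _ IH].
  by rewrite br0l !pbw_lact0 /pbw_lact linear0 scaler0 addr0.
rewrite (clr_linl L_color) !pbw_lact_linearl pbw_lact_linear scalerDr addrACA IH; congr (_ + _).
rewrite [eps a b *: _]scalerA [eps a b * a1]mulrC -scalerA -scalerDr; congr (_ *: _) => {u' IH}.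
elim: (ldeg_span Dw) => [|a2 l2 w' [q qb ->] _ IH].
  by rewrite br0r !pbw_lact0 /pbw_lact linear0 scaler0 addr0.
rewrite (clr_linr L_color) !pbw_lact_linearl pbw_lact_linear scalerDr addrACA IH; congr (_ + _).
rewrite [eps a b *: _]scalerA [eps a b * a2]mulrC -scalerA -scalerDr; congr (_ *: _) => {w' IH}.
case: p q pa qb => [i g] [j h] /= <- <-.
rewrite !pbw_lact_base /= !(grpact_xact cc) !linearZ /= !(grpactM cc) (cc_group cc h g).
rewrite br_base /pbw_lact linearZ /= lactZ lcoord_rscal (lact_lrmul cc) (xact_commE cc).
rewrite scalerDr addrC -/(brc i j); congr (_ + _); rewrite !scalerA; congr (_ *: _).
(* With both group elements moved to the right, what remains is eps(|v_i||g|, |v_j||h|) chi_h(i) =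
   e_ij chi_g(j), which uses eps(|g|, |h|) = 1. *)
rewrite /ldeg /= (bicharDl eps_bichar) !(bicharDr eps_bichar) (eps_gdeg i) mulr1.
rewrite (eps_antisym (gdeg h)) -/(gveps h i) -/(gveps g j) -/(veps i j).
by field; exact: (cc_chi_neq0 cc).
Qed.

Definition pbw_act : U -> P -> P := uenv_act (eps := eps) (DL := DL) (br := br) pbw_lact pbw_ract.
Local Notation ltI := (fun i j : 'I_n => (i < j)%N).
Local Notation mono := (@pbw_monomial K gT V rho A eps DL br n v).

Lemma pbw_actP : algebra_action pbw_act.
Proof. exact: uenv_actP pbw_uenv_module. Qed.

Lemma pbw_act_lie l x : pbw_act (uL l) x = pbw_lact l x.
Proof. exact: uenv_act_lie pbw_uenv_module _ _. Qed.

Lemma pbw_act_ring r x : pbw_act (uR r) x = pbw_ract r x.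
Proof. exact: uenv_act_ring pbw_uenv_module _ _. Qed.

Lemma pT1 x : pT 1%g x = x.
Proof. by rewrite -pbw_ractU mbase1 (aact1 pbw_ractP). Qed.

Lemma pbw_act_pow i a x : pbw_act (uL (lgen i) ^+ a) x = iter a (pX i) x.
Proof.
elim: a => [|a IH]; first by rewrite expr0 (aact1 pbw_actP).
by rewrite exprS (aactM pbw_actP) IH pbw_act_lie pbw_lact_base pT1.
Qed.

Lemma xact_iter i a m g : mabove i m ->
  iter a (pX i) (zmon (m, g)) = zmon (iter a (mincr i) m, g).
Proof.
move=> im; elim: a => //= a ->; apply: xact_above.
by elim: a => //= a IH; apply: mabove_incr.
Qed.

Lemma iter_mincr i a (m : {ffun 'I_n -> nat}) j :
  iter a (mincr i) m j = (m j + a * (j == i))%N.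
Proof. by elim: a => [|a IH] /=; rewrite ?addn0 // ffunE IH mulSn addnAC addnA. Qed.

Definition mrestr (s : seq 'I_n) (m : {ffun 'I_n -> nat}) : {ffun 'I_n -> nat} :=
  [ffun i => if i \in s then m i else 0%N].

(** The largest index acts first, so each x_i meets a monomial in larger indices only and no lower
    terms arise. *)
Lemma pbw_act_prod (s : seq 'I_n) (m : {ffun 'I_n -> nat}) g : sorted ltI s ->
  pbw_act (\prod_(i <- s) uL (lgen i) ^+ m i) (zmon ([ffun => 0%N], g)) = zmon (mrestr s m, g).
Proof.
have tr : transitive ltI by move=> j i k; exact: ltn_trans.
elim: s => [_|i s IH] /=.
  by rewrite big_nil (aact1 pbw_actP); congr (zmon (_, _)); apply/ffunP => i; rewrite !ffunE.
rewrite (path_sortedE tr) => /andP[/allP is_ /IH E].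
rewrite big_cons (aactM pbw_actP) E pbw_act_pow xact_iter; last first.
  apply/maboveP => j ji; rewrite ffunE; case: ifP => // /is_ ij.
  by have := ltn_trans ij ji; rewrite ltnn.
congr (zmon (_, _)); apply/ffunP => j; rewrite iter_mincr !ffunE inE.
have [->|_] /= := eqVneq j i; last by rewrite muln0 addn0.
by case: ifP => [/is_|_]; rewrite ?ltnn // muln1.
Qed.

Lemma pbw_monomialE (m : {ffun 'I_n -> nat}) g :
  mono (m, g) = (\prod_(i <- enum 'I_n) uL (lgen i) ^+ m i) * uR (mbase g).
Proof. by rewrite enumT /pbw_monomial [index_enum _]unlock. Qed.

Lemma pbw_act_monomial mg : pbw_act (mono mg) (zmon ([ffun => 0%N], 1%g)) = zmon mg.
Proof.
case: mg => m g; rewrite pbw_monomialE (aactM pbw_actP) pbw_act_ring pbw_ractU grpactE.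
rewrite mchi0 scale1r mulg1 pbw_act_prod ?enum_sorted //.
by congr (zmon (_, _)); apply/ffunP => i; rewrite ffunE mem_enum.
Qed.

Lemma pbw_monomial_free (s : seq ({ffun 'I_n -> nat} * gT)) a : uniq s ->
  \sum_(mg <- s) a mg *: mono mg = 0 -> forall mg, mg \in s -> a mg = 0.
Proof.
move=> us h; apply: (@fm_free _ _ P _ _ us).
have <- : pbw_act (\sum_(mg <- s) a mg *: mono mg) (zmon ([ffun => 0%N], 1%g))
    = \sum_(mg <- s) a mg *: zmon mg.
  elim: (s) => [|mg s' IH]; first by rewrite !big_nil (aact0 pbw_actP).
  by rewrite !big_cons (aactDl pbw_actP) (aactZl pbw_actP) pbw_act_monomial IH.
by rewrite h (aact0 pbw_actP).
Qed.

(** * The map psi : P -> U(L) and generation by the monomials *)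

Local Notation ux := (fun i => uL (lgen i)).
Local Notation ug := (fun g => uR (mbase g)).
Local Notation psi := (@pbw_psi K gT n P U ux ug).

Lemma uL_lbase i g : uL (lbase (i, g)) = uL (lgen i) * uR (mbase g).
Proof. by rewrite -uenv_of_rscal lgen_rscal. Qed.

Lemma uLP a l l' : uL (a *: l + l') = a *: uL l + uL l'.
Proof. exact: uenv_of_lie_linear. Qed.
Lemma uL0 : uL 0 = 0.
Proof. exact: linear0. Qed.
Lemma uLD : {morph uL : l l' / l + l'}.
Proof. by move=> l l'; rewrite -[l]scale1r uLP !scale1r. Qed.
Lemma uLZ a l : uL (a *: l) = a *: uL l.
Proof. by rewrite -[a *: l]addr0 uLP uL0 addr0. Qed.
Lemma uRP a r r' : uR (a *: r + r') = a *: uR r + uR r'.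
Proof. exact: uenv_of_ring_linear. Qed.
Lemma uR0 : uR 0 = 0.
Proof. exact: linear0. Qed.
Lemma psiP a x y : psi (a *: x + y) = a *: psi x + psi y.
Proof. exact: linearP. Qed.
Lemma psi0 : psi 0 = 0.
Proof. exact: linear0. Qed.

Lemma uenv_pbw_relations : pbw_relations veps gveps brc (ux : 'I_n -> U) ug.
Proof.
split=> [|g h|g i|i j].
- by rewrite mbase1 uenv_of_ring1.
- by rewrite -mbaseM uenv_of_ringM.
- by rewrite -uenv_of_lscal -uL_lbase lbase_lscal mulg1 uLZ.
rewrite (uenv_of_lieM eps br (lgen_deg i) (lgen_deg j)) -/(veps i j); congr (_ + _).
rewrite [br _ _]lcoordE (big_morph uL uLD uL0); apply: eq_bigr => -[k g] _.
by rewrite -uL_lbase -uLZ.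
Qed.

Lemma uL_psi_base p x : uL (lbase p) * psi x = psi (pbw_lact (lbase p) x).
Proof.
have rel := uenv_pbw_relations.
by case: p => i g; rewrite uL_lbase -mulrA (psi_grpact rel) pbw_lact_base (psi_xact rel).
Qed.

Lemma uL_psi l x : uL l * psi x = psi (pbw_lact l x).
Proof.
elim/lbase_ind: l => [|a p l IH]; first by rewrite pbw_lact0 uL0 mul0r psi0.
by rewrite pbw_lact_linearl uLP psiP mulrPl IH uL_psi_base.
Qed.

Lemma uR_psi r x : uR r * psi x = psi (pbw_ract r x).
Proof.
elim/monoid_alg_ind: r => [|a g r IH].
  by rewrite uR0 mul0r (aact0 pbw_ractP) psi0.
rewrite uRP (aactPl pbw_ractP) psiP mulrPl IH pbw_ractU.
by rewrite (psi_grpact uenv_pbw_relations).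
Qed.

(** By [uenv_ind] it suffices to treat the generators from L and KG, where psi is known to
    intertwine. *)
Lemma uenv_psi u x : u * psi x = psi (pbw_act u x).
Proof.
elim/uenv_ind: u x => [r|l u IH|a u u' IH IH'] x.
- by rewrite pbw_act_ring uR_psi.
- by rewrite -mulrA IH uL_psi (aactM pbw_actP) pbw_act_lie.
- by rewrite mulrPl IH IH' (aactPl pbw_actP) psiP.
Qed.

Lemma psiE mg : psi (zmon mg) = mono mg.
Proof. by case: mg => m g; rewrite pbw_psiE pbw_monomialE. Qed.

Lemma pbw_monomial_basis : is_basis mono.
Proof.
split=> [u|s a us h]; last exact: pbw_monomial_free.
pose z : P := zmon ([ffun => 0%N], 1%g).
have [s [a E]] := fm_span (pbw_act u z).
(* The coefficients are those of u z_(0, 1) in P; psi sends z_(0, 1) to 1, which leaves u = psi(u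
   z_(0, 1)). *)
exists s, a; have := uenv_psi u z.
rewrite E pbw_psiE mbase1 uenv_of_ring1 mulr1 big1 ?mulr1 => [->|i _]; last first.
  by rewrite ffunE expr0.
by rewrite linear_sum; apply: eq_bigr => mg _; rewrite linearZ /= psiE.
Qed.

End YetterDrinfeldPbw.

Theorem corollary7p3
  (K : fieldType) (K_char0 : [pchar K] =i pred0)
  (gT : finGroupType) (G_abelian : abelian [set: gT])
  (V : vectType K) (rho : linear_action gT V)
  (A : zmodType) (eps : A -> A -> K)
  (eps_bichar : bicharacter eps) (eps_antisym : antisymmetric_bichar eps)
  (DG : A -> monoid_alg K gT -> Prop) (DG_graded : graded_algebra DG)
  (G_homogeneous : group_homogeneous DG)
  (DL : A -> smash_bimod rho -> Prop)
  (br : smash_bimod rho -> smash_bimod rho -> smash_bimod rho)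
  (L_color : color_lie_ring eps DG DL br)
  (DV : A -> V -> Prop) (L_YD : yetter_drinfeld eps DG DL DV)
  (L_pos : purely_positive eps DV)
  (eps_group : trivial_on_group V eps DG)
  (n : nat) (v : n.-tuple V) (v_basis : basis_of fullv v)
  (v_homogeneous : forall i, exists a, DV a (tnth v i)) :
  is_basis (@pbw_monomial K gT V rho A eps DL br n v).
Proof.
(* Degrees of the v_i and of the group elements are chosen as functions, by finite choice. *)
have [vdeg v_deg] := fin_all_exists v_homogeneous.
have [gdeg g_deg] := fin_all_exists G_homogeneous.
exact: (pbw_monomial_basis K_char0 G_abelian eps_bichar eps_antisym DG_graded
  L_color L_YD L_pos eps_group v_basis v_deg g_deg).
Qed.
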